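(* Let $r,k$ be positive integers and let $n\ge 2r$ be an integer. For $\tilde\pi\in\tilde\Pi_{2(r),k}$ whose unbarred and barred elements have multiplicities given by $\boldsymbol{a}\in W_{r,k}$ and $\boldsymbol{b}\in W_{r,k}$ respectively, set $\mathcal{D}_{\tilde\pi}=s_{\boldsymbol{a}}\mathcal{L}_\pi s_{\boldsymbol{b}}\in s_{\boldsymbol{a}}P_r(n)s_{\boldsymbol{b}}$, where $\pi\in\Pi_{2(r)}$ is any set partition with $\kappa_{\boldsymbol{a},\boldsymbol{b}}(\pi)=\tilde\pi$. Then $\mathcal{D}_{\tilde\pi}$ does not depend on the choice of $\pi$, and $\{\mathcal{D}_{\tilde\pi}:\tilde\pi\in\tilde\Pi_{2(r),k}\}$ is a basis of the painted algebra $$\tilde P_{r,k}(n)=\bigoplus_{\boldsymbol{a},\boldsymbol{b}\in W_{r,k}}s_{\boldsymbol{a}}P_r(n)s_{\boldsymbol{b}}\;\cong\;\mathrm{End}_{\mathfrak{S}_n}(\mathcal{P}^r(V_{n,k})).$$ Moreover, if $\tilde\pi$ has multiplicities $\boldsymbol{a}$ (unbarred) and $\boldsymbol{b}$ (barred), $\tilde\nu$ has multiplicities $\boldsymbol{b}'$ (unbarred) and $\boldsymbol{c}$ (barred), and $\kappa_{\boldsymbol{a},\boldsymbol{b}}(\pi)=\tilde\pi$, $\kappa_{\boldsymbol{b}',\boldsymbol{c}}(\nu)=\tilde\nu$, then $$\mathcal{D}_{\tilde\pi}\mathcal{D}_{\tilde\nu}=\frac{\delta_{\boldsymbol{b},\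boldsymbol{b}'}}{|\mathfrak{S}_{\boldsymbol{b}}|}\sum_{\sigma\in\mathfrak{S}_{\boldsymbol{b}}}s_{\boldsymbol{a}}\mathcal{L}_\pi\mathcal{L}_{\sigma.\nu}s_{\boldsymbol{c}}.$$
   Context: $[r]=\{1,\dots,r\}$ and $[\bar r]=\{\bar1,\dots,\bar r\}$ (barred numbers). $\Pi_{2(r)}$ is the set of set partitions of $[r]\cup[\bar r]$, drawn as diagrams (graphs up to having the same connected components) with top vertices $1,\dots,r$ and bottom vertices $\bar1,\dots,\bar r$. The partition algebra $P_r(n)$ is the $\mathbb{C}$-algebra with diagram basis $\{\mathcal{L}_\pi:\pi\in\Pi_{2(r)}\}$ and product $\mathcal{L}_\pi\mathcal{L}_\nu=n^{c(\pi,\nu)}\mathcal{L}_\gamma$: place the diagram of $\pi$ above that of $\nu$, identifying bottom vertex $\bar i$ of $\pi$ with top vertex $i$ of $\nu$; $\gamma$ is the resulting connectivity of the very top and very bottom rows, and $c(\pi,\nu)$ is the number of components lying entirely in the middle row. For $n\ge 2r$, $P_r(n)\cong\mathrm{End}_{\mathfrak{S}_n}((\mathbb{C}^n)^{\otimes r})$. For $\sigma\in\mathfrak{S}_r$, $\mathcal{L}_\sigma$ is the diagram basis element of $\{\{\sigma(1),\bar1\},\dots,\{\sigma(r),\bar r\}\}$; $\sigma.\nu$ is the set partition obtained from $\nu$ by replacing each unbarred $i$ with $\sigma(i)$, so $\mathcal{L}_\sigma\mathcal{L}_\nu=\mathcal{L}_{\sigma.\nu}$. $W_{r,k}$ is the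 set of sequences $\boldsymbol{a}=(\boldsymbol{a}_1,\dots,\boldsymbol{a}_k)$ of non-negative integers with sum $r$; $\mathfrak{S}_{\boldsymbol{a}}\subseteq\mathfrak{S}_r$ is the Young subgroup permuting separately the consecutive intervals of lengths $\boldsymbol{a}_1,\dots,\boldsymbol{a}_k$; $s_{\boldsymbol{a}}=\frac1{|\mathfrak{S}_{\boldsymbol{a}}|}\sum_{\sigma\in\mathfrak{S}_{\boldsymbol{a}}}\mathcal{L}_\sigma$. $\tilde\Pi_{2(r),k}$ is the set of multiset partitions (multisets of nonempty multisets, ''blocks'') with a total of $r$ elements from $[k]$ and $r$ elements from $[\bar k]$, counted with multiplicity. The coloring map $\kappa_{\boldsymbol{a},\boldsymbol{b}}:\Pi_{2(r)}\to\tilde\Pi_{2(r),k}$ replaces each unbarred $i$ by the index $j\in[k]$ of the consecutive interval (of lengths $\boldsymbol{a}_1,\dots,\boldsymbol{a}_k$) of $[r]$ containing $i$, and each $\bar i$ by $\bar j$ where $j$ is the index of the consecutive interval (of lengths $\boldsymbol{b}_1,\dots,\boldsymbol{b}_k$) containing $i$. The painted algebra product on $\bigoplus_{\boldsymbol{a},\boldsymbol{b}}s_{\boldsymbol{a}}P_r(n)s_{\boldsymbol{b}}$ (external direct sum) is $(s_{\boldsymbol{a}}\varphi s_{\boldsymbol{b}})\cdot(s_{\boldsymbol{c}}\psi s_{\boldsymbol{d}})=\delta_{\boldsymbol{b},\boldsymbol{c}}\,s_{\boldsymbol{a}}\varphi s_{\boldsymbol{b}}\psi s_{\boldsymbol{d}}$.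 $\mathcal{P}^r(V_{n,k})$ is the space of homogeneous polynomials of degree $r$ in $x_{ij}$ ($1\le i\le n$, $1\le j\le k$), i.e. polynomial functions on $n\times k$ matrices, with $\mathfrak{S}_n\subseteq GL_n$ (permutation matrices) acting by $(M.f)(X)=f(M^{-1}X)$. The multiset partition algebra $\mathrm{MP}_{r,k}(n)$ is $\mathrm{End}_{\mathfrak{S}_n}(\mathcal{P}^r(V_{n,k}))$. *)

(* Defs.v *)
From HB Require Import structures.
From mathcomp Require Import all_boot all_order all_fingroup all_algebra.
From mathcomp Require Import finmap multiset mpoly.
From mathcomp Require Import reals complex.

Set Implicit Arguments.
Unset Strict Implicit.
Unset Printing Implicit Defensive.

Import Order.TTheory GRing.Theory.

Local Open Scope mset_scope.
Local Open Scope ring_scope.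

(* The vertex set [r] + [rbar]: [inl i] is the unbarred (top) vertex i and
   [inr i] is the barred (bottom) vertex i; everything is indexed from 0. *)
Definition vertex (r : nat) : finType := ('I_r + 'I_r)%type.

Section Diagrams.
Variable r : nat.
Implicit Types (s : 'S_r) (u : vertex r).

Definition setpart : finType :=
  {P : {set {set vertex r}} | partition P [set: vertex r]}.

Definition Setpart (P : {set {set vertex r}}) : partition P [set: vertex r] ->
  setpart := @exist _ _ P.

Implicit Types p q : setpart.

(* Stacking p above q uses three rows of vertices: [inl (inl i)] is in the top
   row, [inl (inr i)] in the middle row and [inr i] in the bottom row. *)
Definition stacked : finType := (vertex r + 'I_r)%type.

Definition upper u : stacked := inl u.

Definition lower u : stacked :=
  match u with inl i => inl (inr i) | inr i => inr i end.

Definition outer u : stacked :=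
  match u with inl i => inl (inl i) | inr i => inr i end.

Definition middle_row : {set stacked} := [set inl (inr i) | i : 'I_r].

Definition stack_adj p q : rel stacked := fun x y =>
  [exists B in val p, (x \in upper @: B) && (y \in upper @: B)]
  || [exists B in val q, (x \in lower @: B) && (y \in lower @: B)].

Definition stack_conn p q : rel stacked := connect (stack_adj p q).

Definition nmiddle p q : nat :=
  #|[set C in equivalence_partition (stack_conn p q) [set: stacked]
     | C \subset middle_row]|.

Lemma stack_conn_equiv p q : equivalence_rel (stack_conn p q).
Proof.
have sym : connect_sym (stack_adj p q).
  apply: sym_connect_sym => x y; rewrite /stack_adj.
  by congr (_ || _); apply: eq_existsb => B; rewrite [in RHS](andbC (y \in _)).
by apply/equivalence_relP; split=> [x|x y xy z];
  rewrite /stack_conn ?connect0 // (same_connect sym xy).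
Qed.

Lemma comp_diag_proof p q :
  partition (equivalence_partition
    (fun u v => stack_conn p q (outer u) (outer v)) [set: vertex r])
    [set: vertex r].
Proof.
apply: equivalence_partitionP => x y z _ _ _.
exact: stack_conn_equiv.
Qed.

Definition comp_diag p q : setpart := Setpart (comp_diag_proof p q).

Lemma perm_diag_proof s :
  partition [set ([set inl (s i); inr i] : {set vertex r}) | i : 'I_r]
            [set: vertex r].
Proof.
pose h u := match u with inl j => (s^-1)%g j | inr i => i end.
suff -> : [set ([set inl (s i); inr i] : {set vertex r}) | i : 'I_r]
          = preim_partition h [set: vertex r] by exact: preim_partitionP.
have blk i : [set inl (s i); inr i] = [set v in [set: vertex r] | i == h v].
  apply/setP=> -[j|j]; rewrite !inE /=; last by rewrite eq_sym.
  rewrite orbF (inj_eq inl_inj) -(inj_eq (@perm_inj _ s) i) permKV; exact: eq_sym.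
apply/setP=> B; apply/imsetP/imsetP => [[i _ ->]|[u _ ->]].
  by exists (inr i); rewrite ?inE // blk.
by exists (h u); rewrite ?inE // blk.
Qed.

Definition perm_diag s : setpart := Setpart (perm_diag_proof s).

Definition relabel s u : vertex r :=
  match u with inl i => inl (s i) | inr i => inr i end.

Lemma relabel_inj s : injective (relabel s).
Proof. by move=> [i|i] [j|j] //= [ij]; congr (_ _); first exact: perm_inj ij. Qed.

Lemma act_diag_proof s p :
  partition [set relabel s @: (B : {set vertex r}) | B in val p]
            [set: vertex r].
Proof.
have sT : relabel s @: [set: vertex r] = [set: vertex r].
  by apply/eqP; rewrite eqEcard subsetT (card_imset _ (@relabel_inj s)) leqnn.
rewrite -[X in partition _ X]sT (imset_partition _ _ (@relabel_inj s)).
exact: valP p.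
Qed.

(* sigma.nu: only the unbarred vertices are relabelled. *)
Definition act_diag s p : setpart := Setpart (act_diag_proof s p).

End Diagrams.

Section Painting.
Variables r k : nat.

(* Sequences of k non-negative integers with sum r; the entries are
   automatically bounded by r, so storing them in 'I_r.+1 loses nothing. *)
Definition wcomp : finType :=
  {a : {ffun 'I_k -> 'I_r.+1} | (\sum_(j < k) a j)%N == r}.

Definition Wcomp (a : {ffun 'I_k -> 'I_r.+1}) : (\sum_(j < k) a j)%N == r ->
  wcomp := @exist _ _ a.

Implicit Types a b : wcomp.

(* The j-th of the consecutive intervals of [r] of lengths a_0, a_1, ... *)
Definition itv_of a (j : 'I_k) : {set 'I_r} :=
  [set i : 'I_r | (\sum_(l < k | l < j) val a l <= i
                     < \sum_(l < k | l <= j) val a l)%N].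

Lemma color_proof a (i : 'I_r) : exists j, i \in itv_of a j.
Proof.
have [j0 Pj0] : exists j : 'I_k, (i < \sum_(l < k | l <= j) val a l)%N.
  have ar := eqP (valP a).
  case k_gt0 : (0 < k)%N; last first.
    have := ltn_ord i; rewrite -[X in (_ < X)%N]ar big1 ?ltn0 // => -[l ltl] _.
    by rewrite (leq_ltn_trans _ ltl) in k_gt0.
  have k1 : (k.-1 < k)%N by rewrite prednK.
  exists (Ordinal k1); rewrite (eq_bigl xpredT) ?ar // => l /=.
  by rewrite -ltnS prednK ?ltn_ord.
pose P (j : 'I_k) := (i < \sum_(l < k | l <= j) val a l)%N.
case: (@arg_minnP _ j0 P (fun j => val j) Pj0) => j Pj minj.
exists j; rewrite inE [X in _ && X]Pj andbT leqNgt; apply/negP => lt_i.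
case: j Pj minj lt_i => -[|j] ltj Pj minj lt_i; first by rewrite big_pred0 in lt_i.
have /minj : P (Ordinal (ltnW ltj)) by [].
by rewrite ltnn.
Qed.

Definition color a (i : 'I_r) : 'I_k := xchoose (color_proof a i).

Definition young a : {set 'S_r} := (\bigcap_(j < k) 'N(itv_of a j | 'P))%g.

Definition paint a b (u : vertex r) : vertex k :=
  match u with inl i => inl (color a i) | inr i => inr (color b i) end.

(* The multiplicity of x in the sum of all blocks of m. *)
Definition mcount (m : {mset {mset vertex k}}) (x : vertex k) : nat :=
  (\sum_(B <- m : multiset _) (B : {mset vertex k}) x)%N.

Definition is_mpart (m : {mset {mset vertex k}}) : bool :=
  [&& mset0 \notin m, (\sum_(j < k) mcount m (inl j))%N == r
    & (\sum_(j < k) mcount m (inr j))%N == r].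

Definition mpart := {m : {mset {mset vertex k}} | is_mpart m}.

HB.instance Definition _ := Choice.on mpart.

Lemma mcount_unbarred (m : mpart) (j : 'I_k) : (mcount (val m) (inl j) <= r)%N.
Proof. by have /and3P[_ /eqP<- _] := valP m; rewrite (bigD1 j) //= leq_addr. Qed.

Lemma mcount_barred (m : mpart) (j : 'I_k) : (mcount (val m) (inr j) <= r)%N.
Proof. by have /and3P[_ _ /eqP<-] := valP m; rewrite (bigD1 j) //= leq_addr. Qed.

Lemma mcount_le (m : mpart) x : (mcount (val m) x <= r)%N.
Proof. by case: x => j; rewrite ?mcount_unbarred ?mcount_barred. Qed.

(* The multiset partitions form a finite set: all multiplicities, of elements
   in blocks and of blocks, are at most r. *)
Definition block_of (B : {ffun vertex k -> 'I_r.+1}) : {mset vertex k} :=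
  seq_mset (flatten [seq nseq (B x) x | x : vertex k]).

Lemma count_flatten_nseq (I : finType) (T : eqType) (f : I -> nat) (g : I -> T) y :
  count_mem y (flatten [seq nseq (f x) (g x) | x : I])
  = (\sum_(x | g x == y) f x)%N.
Proof.
rewrite count_flatten sumnE -map_comp big_map big_enum /= [RHS]big_mkcond.
by apply: eq_bigr => x _; rewrite count_nseq /=; case: eqP; rewrite ?mul1n.
Qed.

Lemma block_ofE B x : block_of B x = B x.
Proof. by rewrite mset_seqE count_flatten_nseq big_pred1_eq. Qed.

Definition mpart_code (m : mpart) : {ffun {ffun vertex k -> 'I_r.+1} -> 'I_r.+1} :=
  [ffun B => inord (val m (block_of B))].

Definition mpart_decode (f : {ffun {ffun vertex k -> 'I_r.+1} -> 'I_r.+1}) :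
    option mpart :=
  insub (seq_mset (flatten [seq nseq (f B) (block_of B) | B : {ffun vertex k -> 'I_r.+1}])).

Lemma mpart_codeK : pcancel mpart_code mpart_decode.
Proof.
move=> m; suff dec : seq_mset (flatten [seq nseq (mpart_code m B) (block_of B)
    | B : {ffun vertex k -> 'I_r.+1}]) = val m.
  by rewrite /mpart_decode dec valK.
have memle (B : {mset vertex k}) : B \in val m -> forall x, (val m B * B x <= r)%N.
  move=> Bm x; apply: leq_trans (mcount_le m x).
  rewrite /mcount sum_mset (big_fsetD1 B) ?leq_addr //.
  by rewrite multiset.msuppE.
have multle (B : {mset vertex k}) : (val m B <= r)%N.
  have [Bm|/mset_eq0P -> //] := boolP (B \in val m).
  have /and3P[m0 _ _] := valP m.
  have [x xB|B0] := pickP (fun x => x \in B).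
    by apply: leq_trans (memle B Bm x); rewrite leq_pmulr // mset_gt0.
  case/negP: m0; suff -> : mset0 = B by [].
  by apply/msetP => x; rewrite mset0E; apply/esym/eqP; rewrite mset_eq0 B0.
apply/msetP => B; rewrite mset_seqE count_flatten_nseq.
have [Bm|BNm] := boolP (B \in val m); last first.
  rewrite (mset_eq0P BNm) big1 // => B' /eqP BB'.
  by rewrite ffunE BB' (mset_eq0P BNm) inordK.
have Br x : (B x < r.+1)%N.
  rewrite ltnS; apply: leq_trans (memle B Bm x).
  by rewrite leq_pmull // mset_gt0.
pose B0 : {ffun vertex k -> 'I_r.+1} := [ffun x => inord (B x)].
have B0E : block_of B0 = B.
  by apply/msetP => x; rewrite block_ofE ffunE inordK.
rewrite (big_pred1 B0) => [|B'].
  by rewrite ffunE B0E inordK // ltnS.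
apply/eqP/eqP => [B'E|->//]; apply/ffunP => x; apply: val_inj.
by rewrite /= -block_ofE B'E -B0E block_ofE.
Qed.

HB.instance Definition _ : isCountable mpart := PCanIsCountable mpart_codeK.
HB.instance Definition _ : isFinite mpart := PCanIsFinite mpart_codeK.

Lemma umult_proof (m : mpart) :
  (\sum_(j < k) [ffun j => inord (mcount (val m) (inl j)) : 'I_r.+1] j)%N == r.
Proof.
have /and3P[_ /eqP mr _] := valP m; apply/eqP; rewrite -[RHS]mr.
by apply: eq_bigr => j _; rewrite ffunE inordK // ltnS mcount_le.
Qed.

Lemma bmult_proof (m : mpart) :
  (\sum_(j < k) [ffun j => inord (mcount (val m) (inr j)) : 'I_r.+1] j)%N == r.
Proof.
have /and3P[_ _ /eqP mr] := valP m; apply/eqP; rewrite -[RHS]mr.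
by apply: eq_bigr => j _; rewrite ffunE inordK // ltnS mcount_le.
Qed.

(* Multiplicities of the unbarred and of the barred elements. *)
Definition umult (m : mpart) : wcomp := Wcomp (umult_proof m).
Definition bmult (m : mpart) : wcomp := Wcomp (bmult_proof m).

Lemma umultE m j : val (umult m) j = mcount (val m) (inl j) :> nat.
Proof. by rewrite /= ffunE inordK // ltnS mcount_le. Qed.

Lemma bmultE m j : val (bmult m) j = mcount (val m) (inr j) :> nat.
Proof. by rewrite /= ffunE inordK // ltnS mcount_le. Qed.

Definition paint_diag a b (p : setpart r) : {mset {mset vertex k}} :=
  seq_mset [seq seq_mset [seq paint a b u | u <- enum B]
           | B : {set vertex r} <- enum (val p)].

Lemma kappa_proof a b p : is_mpart (paint_diag a b p).
Proof.
have part := valP p; rewrite /= in part.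
have cnt x : mcount (paint_diag a b p) x = (\sum_u (paint a b u == x))%N.
  rewrite /mcount (perm_big _ (perm_eq_seq_mset _)) /= big_map big_enum /=.
  have -> : (\sum_u (paint a b u == x) =
      \sum_(u in [set: vertex r]) (paint a b u == x))%N.
    by apply: eq_bigl => u; rewrite inE.
  rewrite (set_partition_big _ part); apply: eq_bigr => B _.
  rewrite mset_seqE -sum1_count big_map big_enum_cond big_mkcondr /=.
  by apply: eq_bigr => u _; case: eqP.
apply/and3P; split.
- rewrite (perm_mem (perm_eq_seq_mset _)); apply/mapP => -[B].
  rewrite mem_enum => Bp /msetP B0; have /set0Pn[u uB] := partition_neq0 part Bp.
  have := B0 (paint a b u); rewrite mset0E mset_seqE => /esym/count_memPn/negP.
  by apply; rewrite map_f ?mem_enum.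
- under eq_bigr => j _ do rewrite cnt.
  rewrite exchange_big /= big_sumType /= [X in (_ + X)%N]big1 ?addn0 => [|i _].
    rewrite -[X in _ == X](card_ord r) -sum1_card; apply/eqP/eq_bigr => i _.
    rewrite (bigD1 (color a i)) //= eqxx big1 // => j; rewrite eq_sym.
    by rewrite (inj_eq inl_inj) => /negbTE ->.
  by apply: big1.
under eq_bigr => j _ do rewrite cnt.
rewrite exchange_big /= big_sumType /= big1 ?add0n => [|i _].
  rewrite -[X in _ == X](card_ord r) -sum1_card; apply/eqP/eq_bigr => i _.
  rewrite (bigD1 (color b i)) //= eqxx big1 // => j; rewrite eq_sym.
  by rewrite (inj_eq inr_inj) => /negbTE ->.
by apply: big1.
Qed.

Definition kappa a b p : mpart := exist is_mpart _ (kappa_proof a b p).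

End Painting.

Section PartitionAlgebra.
Variables (F : fieldType) (r : nat).

Definition palg : vectType F := {ffun setpart r -> F^o}.

Definition Ldiag (p : setpart r) : palg := [ffun q => (q == p)%:R].

(* The product of P_r(n), extended bilinearly from the diagram basis. *)
Definition pmul (n : nat) (x y : palg) : palg :=
  \sum_p \sum_q (x p * y q * n%:R ^+ nmiddle p q) *: Ldiag (comp_diag p q).

Lemma pmul_diag n p q :
  pmul n (Ldiag p) (Ldiag q) = n%:R ^+ nmiddle p q *: Ldiag (comp_diag p q).
Proof.
rewrite /pmul (bigD1 p) //= [X in _ + X]big1 ?addr0 => [|p' /negbTE p'p].
  rewrite (bigD1 q) //= big1 ?addr0 => [|q' /negbTE q'q].
    by rewrite !ffunE !eqxx !mul1r.
  by rewrite !ffunE q'q mulr0 mul0r scale0r.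
by apply: big1 => q' _; rewrite !ffunE p'p !mul0r scale0r.
Qed.

Lemma pmul_linearl n y : linear (pmul n ^~ y).
Proof.
move=> c x x'; rewrite /pmul scaler_sumr -big_split; apply: eq_bigr => p _ /=.
rewrite scaler_sumr -big_split; apply: eq_bigr => q _ /=.
by rewrite scalerA -scalerDl !ffunE !mulrDl /GRing.scale /= !mulrA.
Qed.

Lemma pmul_linearr n x : linear (pmul n x).
Proof.
move=> c y y'; rewrite /pmul scaler_sumr -big_split; apply: eq_bigr => p _ /=.
rewrite scaler_sumr -big_split; apply: eq_bigr => q _ /=.
rewrite scalerA -scalerDl !ffunE mulrDr mulrDl /GRing.scale /= !mulrA.
by rewrite (mulrC (x p) c).
Qed.

End PartitionAlgebra.

Section PaintedAlgebra.
Variables (F : fieldType) (r k n : nat).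
Implicit Types (a b c d : wcomp r k) (phi : palg F r).

(* s_a *)
Definition symm a : palg F r :=
  #|young a|%:R^-1 *: \sum_(s in young a) Ldiag F (perm_diag s).

Definition sandwich a b phi : palg F r := pmul n (pmul n (symm a) phi) (symm b).

Lemma sandwich_is_linear a b : linear (sandwich a b).
Proof. by move=> c x y; rewrite /sandwich pmul_linearr pmul_linearl. Qed.

HB.instance Definition _ a b :=
  GRing.isLinear.Build F (palg F r) (palg F r) *:%R (sandwich a b)
    (sandwich_is_linear a b).

(* s_a P_r(n) s_b *)
Definition corner a b : {vspace palg F r} := limg (linfun (sandwich a b)).

(* A family x indexed by pairs (a, b) has x (a, b) as its component in the
   summand (a, b) of the external direct sum; [painted] is the subspace of the
   families with x (a, b) in s_a P_r(n) s_b, see [paintedP]. *)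
Definition painted_fam : vectType F := {ffun wcomp r k * wcomp r k -> palg F r}.

Definition summand_inj a b phi : painted_fam :=
  [ffun ab => if ab == (a, b) then phi else 0].

Lemma summand_inj_is_linear a b : linear (summand_inj a b).
Proof.
move=> c x y; apply/ffunP => ab; rewrite !ffunE.
by case: eqP => // _; rewrite scaler0 addr0.
Qed.

HB.instance Definition _ a b :=
  GRing.isLinear.Build F (palg F r) painted_fam *:%R (summand_inj a b)
    (summand_inj_is_linear a b).

Definition painted : {vspace painted_fam} :=
  (\sum_(ab : wcomp r k * wcomp r k)
     linfun (summand_inj ab.1 ab.2) @: corner ab.1 ab.2)%VS.

Lemma paintedP (x : painted_fam) :
  reflect (forall a b, exists phi, x (a, b) = sandwich a b phi) (x \in painted).
Proof.
apply: (iffP memv_sumP) => [[vs vsP ->] a b|xP].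
  have /memv_imgP[y /memv_imgP[phi _ ->] vsE] := vsP (a, b) isT.
  exists phi; rewrite sum_ffunE (bigD1 (a, b)) //= big1 => [|[c d] cd].
    by rewrite addr0 vsE !lfunE /= ffunE eqxx.
  have /memv_imgP[z _ ->] := vsP (c, d) isT.
  by rewrite lfunE /= ffunE eq_sym (negbTE cd).
exists (fun ab => summand_inj ab.1 ab.2 (x ab)) => [[a b] _|].
  have [phi xE] := xP a b; apply/memv_imgP; exists (x (a, b)); rewrite ?lfunE //.
  by apply/memv_imgP; exists phi; rewrite ?memvf ?lfunE.
apply/ffunP => ab; rewrite sum_ffunE (bigD1 ab) //= big1 => [|cd cd_ab].
  by rewrite addr0 ffunE -surjective_pairing eqxx.
by rewrite ffunE -surjective_pairing eq_sym (negbTE cd_ab).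
Qed.

(* Bilinear extension of the product of components, see
   [painted_mul_summand]. *)
Definition painted_mul (x y : painted_fam) : painted_fam :=
  [ffun ad => \sum_b pmul n (x (ad.1, b)) (y (b, ad.2))].

Lemma painted_mul_summand a b c d phi psi :
  painted_mul (summand_inj a b phi) (summand_inj c d psi)
  = (b == c)%:R *: summand_inj a d (pmul n phi psi).
Proof.
have pmul0l y : pmul n 0 y = 0 :> palg F r.
  by have := pmul_linearl n y (-1) 0 0; rewrite scaler0 addr0 scaleN1r addNr.
have pmul0r y : pmul n y 0 = 0 :> palg F r.
  by have := pmul_linearr n y (-1) 0 0; rewrite scaler0 addr0 scaleN1r addNr.
apply/ffunP => -[a' d']; rewrite !ffunE (bigD1 b) //= big1 => [|b' b'b].
  rewrite addr0 !ffunE !xpair_eqE eqxx andbT /=.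
  have [_|_] := eqVneq a' a; last by rewrite pmul0l scaler0.
  have [_|_] := eqVneq b c; last by rewrite pmul0r scale0r.
  by case: eqP => _ /=; rewrite ?pmul0r ?scaler0 ?scale1r.
by rewrite !ffunE !xpair_eqE (negbTE b'b) andbF pmul0l.
Qed.

Definition painted_one : painted_fam :=
  [ffun ab => if ab.1 == ab.2 then symm ab.1 else 0].

(* The default value 0 is never used, as kappa a b reaches every multiset
   partition with multiplicities a and b. *)
Definition Dbasis (m : mpart r k) : painted_fam :=
  if [pick p | kappa (umult m) (bmult m) p == m] is Some p
  then summand_inj (umult m) (bmult m) (sandwich (umult m) (bmult m) (Ldiag F p))
  else 0.

End PaintedAlgebra.

Section MultisetPartitionAlgebra.
Variables (F : fieldType) (r k n : nat).

(* The generic n x k matrix (x_ij). *)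
Definition generic_mx : 'M[{mpoly F[n * k]}]_(n, k) := vec_mx (\row_l 'X_l).

(* (M.f)(X) = f(M^-1 X) *)
Definition mx_act (M : 'M[F]_n) (f : {mpoly F[n * k]}) : {mpoly F[n * k]} :=
  f \mPo [tuple mxvec (map_mx (@mpolyC (n * k) F) (invmx M) *m generic_mx) ord0 l
          | l < n * k].

Lemma mx_act_homog (M : 'M[F]_n) (f : {mpoly F[n * k]}) :
  f \is r.-homog -> mx_act M f \is r.-homog.
Proof.
have lin l : (mxvec (map_mx (@mpolyC (n * k) F) (invmx M) *m generic_mx) ord0 l)
    \is 1.-homog.
  case/mxvec_indexP: l => i j; rewrite mxvecE mxE; apply: rpred_sum => l _.
  rewrite !mxE mul_mpolyC; apply: rpredZ.
  by rewrite dhomogX /= mdeg1.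
move=> /dhomogP f_r; rewrite /mx_act comp_mpolyE big_seq; apply: rpred_sum => m mf.
apply: rpredZ; rewrite -(f_r m mf) /= mdegE.
elim/big_rec2: _ => [|l p d _ hp]; first exact: dhomog1.
apply: dhomogM hp; rewrite tnth_mktuple -[X in X.-homog]mul1n.
exact: dhomogMn.
Qed.

(* P^r(V_{n,k}) *)
Definition hpoly : lmodType F := dhomog (n * k) F r.

Definition hpoly_act (M : 'M[F]_n) (f : hpoly) : hpoly :=
  DHomog (mx_act_homog M (dhomog_is_dhomog f)).

Definition Sn_equivariant (f : hpoly -> hpoly) : Prop :=
  forall (s : 'S_n) p,
    f (hpoly_act (perm_mx s) p) = hpoly_act (perm_mx s) (f p).

End MultisetPartitionAlgebra.

(* Main.v *)
(** The partition algebra acts on the r-th tensor power of F^n, a diagram p having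
    as matrix the indicator of the pairs of words (v, w) that are constant on the
    blocks of p.  For n >= 2r every set partition is the kernel of some pair (v, w),
    so by triangularity for refinement this representation identifies P_r(n) with
    the S_n-invariant matrices; associativity, L_s L_p = L_{s.p}, s_a s_a = s_a and
    the double coset formula for s_a L_p s_b are all checked on matrix entries.

    Two diagrams have the same image under kappa_{a,b} iff they are conjugate under
    S_a x S_b.  Hence s_a L_p s_b only depends on kappa_{a,b}(p), and, being the
    average of the L_q over the orbit of p, it is dual to the functional summing the
    coefficients over a fibre of kappa_{a,b}; this gives the basis.

    A word v coloured by a gives a monomial of P^r(V_{n,k}), and two words coloured by
    a give the same monomial iff they differ by an element of S_a.  An endomorphism
    of P^r(V_{n,k}) is thus the same as a family of matrices indexed by pairs (a, b)
    and invariant under S_a x S_b, and S_n-equivariance of the former is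
    S_n-invariance of the latter. *)

Require Import Defs.
From HB Require Import structures.
From mathcomp Require Import all_boot all_order all_fingroup all_algebra.
From mathcomp Require Import finmap multiset mpoly.
From mathcomp Require Import reals complex.

Set Implicit Arguments.
Unset Strict Implicit.
Unset Printing Implicit Defensive.

Import GRing.Theory.
Local Open Scope ring_scope.

(** * Functions and permutations with prescribed fibre sizes *)

Lemma count_mem_codom (T : finType) (C : eqType) (f : T -> C) c :
  count_mem c (codom f) = #|[pred t | f t == c]|.
Proof. by rewrite codomE count_map cardE enumT size_filter. Qed.

(** List every pair [(c, d)] with multiplicity [mu c d]. The first components rearrange the values
    of [f], so a permutation aligns the list with [T], and [h] reads off the second components. *)
Lemma exists_fun_with_counts (T C D : finType) (f : T -> C) (mu : C -> D -> nat) :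
    (forall c, \sum_d mu c d = #|[pred t | f t == c]|)%N ->
  exists h : T -> D, forall c d, #|[pred t | (f t == c) && (h t == d)]| = mu c d.
Proof.
move=> muE.
pose L := flatten [seq nseq (mu cd.1 cd.2) cd | cd : C * D].
have cntL c d : count_mem (c, d) L = mu c d.
  by rewrite count_flatten_nseq big_pred1_eq.
have /tuple_permP[s sE] : perm_eq (map fst L) (codom_tuple f).
  apply/allP => c _ /=; rewrite count_mem_codom -muE.
  rewrite count_map /L count_flatten -map_comp sumnE big_map big_enum /=.
  transitivity (\sum_c' \sum_d (c' == c) * mu c' d == \sum_d mu c d)%N.
    by rewrite pair_bigA; congr (_ == _); apply: eq_bigr => -[c' d] _; rewrite count_nseq.
  rewrite (bigD1 c) //= [X in (_ + X)%N]big1 ?addn0.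
    by apply/eqP/eq_bigr => d _; rewrite eqxx mul1n.
  by move=> c' /negbTE ->; rewrite big1.
have szL : size L = #|T| by rewrite -(size_map fst) sE size_tuple.
have LsE (i : 'I_#|T|) (x0 : C * D) : (nth x0 L i).1 = f (enum_val (s i)).
  rewrite -(nth_map _ (x0.1)) ?szL // sE -tnth_nth tnth_mktuple.
  by rewrite (tnth_nth x0.1) nth_codom.
(* A default pair for [nth] requires an element of [D], which only a nonempty [T] provides. *)
have [t0 _|T0] := pickP (mem T); last first.
  have noT (t : T) : False by have := T0 t.
  exists (fun t => match noT t with end) => c d; rewrite -cntL.
  have -> : L = [::].
    by apply/size0nil; rewrite szL; apply: eq_card0 => t; have := noT t.
  by apply: eq_card0 => t; have := noT t.
have [d0] : exists d : D, True.
  have : (0 < \sum_d mu (f t0) d)%N.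
    by rewrite muE; apply/card_gt0P; exists t0; rewrite inE.
  by case: (pickP (mem D)) => [d|D0]; [exists d | rewrite big_pred0].
move=> _; pose x0 := (f t0, d0).
pose h t := (nth x0 L ((s^-1)%g (enum_rank t))).2.
have hE t : (f t, h t) = nth x0 L ((s^-1)%g (enum_rank t)).
  by rewrite [RHS]surjective_pairing LsE permKV enum_rankK.
exists h => c d; rewrite -cntL -(mkseq_nth x0 L) szL count_map -val_enum_ord.
rewrite count_map -sum1_count big_enum_cond /=.
have -> : #|[pred t | (f t == c) && (h t == d)]|
    = #|[pred i : 'I_#|T| | nth x0 L i == (c, d)]|.
  pose g (i : 'I_#|T|) := enum_val (s i).
  have g_inj : injective g by move=> i j /enum_val_inj /perm_inj.
  rewrite -(card_image g_inj); apply: eq_card => t.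
  have tE : t = g ((s^-1)%g (enum_rank t)) by rewrite /g permKV enum_rankK.
  by rewrite [t in RHS]tE mem_image // !inE -xpair_eqE hE.
by rewrite -[LHS]sum1_card; apply: eq_bigl => i; rewrite inE.
Qed.

(** Take [T] itself as second label set, with [mu c t] the indicator of [g t = c]: each [t] is then
    hit exactly once, from the fibre of [f] over [g t]. *)
Lemma exists_perm_with_counts (T C : finType) (f g : T -> C) :
    (forall c, #|[pred t | f t == c]| = #|[pred t | g t == c]|) ->
  exists s : {perm T}, forall t, g (s t) = f t.
Proof.
move=> fg; have [|h hE] := @exists_fun_with_counts T C T f (fun c t => (g t == c) : nat).
  move=> c; rewrite fg -[RHS]sum1_card [RHS]big_mkcond.
  by apply: eq_bigr => t _; rewrite inE; case: eqP.
have gh t : g (h t) = f t.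
  apply/eqP; have := hE (f t) (h t); case: eqP => // _ /eqP.
  by rewrite eqn0Ngt => /card_gt0P[]; exists t; rewrite inE !eqxx.
have h_inj : injective h.
  move=> t t' tt'; have := leq_b1 (g (h t) == f t).
  rewrite -hE => /card_le1_eqP; apply; rewrite inE ?eqxx //.
  by rewrite -gh -tt' gh !eqxx.
by exists (perm h_inj) => t; rewrite permE gh.
Qed.

(** * Set partitions as kernels of functions *)

Section Refinement.
Variable r : nat.
Implicit Types p q : setpart r.

Definition blk p (u : vertex r) : {set vertex r} := pblock (val p) u.

Definition kerdiag (T : eqType) (h : vertex r -> T) : setpart r :=
  Setpart (preim_partitionP h [set: vertex r]).

Lemma mem_blk p B u : B \in val p -> (u \in B) = (blk p u == B).
Proof.
move=> Bp; have [trivp covp] := (partition_trivIset (valP p), cover_partition (valP p)).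
apply/idP/eqP => [uB|<-]; first exact: def_pblock.
by rewrite mem_pblock covp inE.
Qed.

Lemma blk_mem p u : blk p u \in val p.
Proof. by apply: pblock_mem; rewrite (cover_partition (valP p)) inE. Qed.

Lemma blk_kerdiag (T : eqType) (h : vertex r -> T) u v :
  (blk (kerdiag h) u == blk (kerdiag h) v) = (h u == h v).
Proof.
rewrite -(mem_blk _ (blk_mem _ v)) /blk /= pblock_equivalence_partition ?inE //.
by move=> x y z _ _ _; split=> // /eqP->.
Qed.

Lemma kerdiag_blk p : kerdiag (blk p) = p.
Proof. by apply: val_inj; exact: preim_partition_pblock (valP p). Qed.

Lemma eq_kerdiag (T T' : eqType) (h : vertex r -> T) (h' : vertex r -> T') :
  (forall u v, (h u == h v) = (h' u == h' v)) -> kerdiag h = kerdiag h'.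
Proof.
move=> hh'; apply: val_inj; rewrite /= /preim_partition /equivalence_partition.
by apply: eq_imset => u; apply/setP => v; rewrite !inE hh'.
Qed.

Definition compat (T : eqType) p (f : vertex r -> T) : bool :=
  [forall u, forall v, (blk p u == blk p v) ==> (f u == f v)].

Lemma compatP (T : eqType) p (f : vertex r -> T) :
  reflect (forall u v, blk p u = blk p v -> f u = f v) (compat p f).
Proof.
apply: (iffP 'forall_forallP) => fP u v; last by apply/implyP=> /eqP /fP ->.
by move=> uv; apply/eqP; have /implyP := fP u v; apply; apply/eqP.
Qed.

Lemma compat_blocksP (T : eqType) p (f : vertex r -> T) :
  reflect (forall B u v, B \in val p -> u \in B -> v \in B -> f u = f v)
          (compat p f).
Proof.
apply: (iffP (compatP p f)) => fP.
  by move=> B u v Bp; rewrite !(mem_blk _ Bp) => /eqP<- /eqP/esym/fP.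
by move=> u v uv; apply: (fP _ _ _ (blk_mem p v)); rewrite (mem_blk _ (blk_mem p v)) ?uv.
Qed.

Lemma eq_compat (T : eqType) p (f f' : vertex r -> T) :
  f =1 f' -> compat p f = compat p f'.
Proof.
by move=> ff'; apply: eq_forallb => u; apply: eq_forallb => v; rewrite !ff'.
Qed.

Lemma compat_kerdiag (T : eqType) p (f : vertex r -> T) :
  compat p f = compat p (blk (kerdiag f)).
Proof.
by apply: eq_forallb => u; apply: eq_forallb => v; rewrite blk_kerdiag.
Qed.

(* The measure making refinement of set partitions a well-founded triangular order. *)
Definition nrelated p : nat := #|[pred uv | blk p uv.1 == blk p uv.2]|.

Lemma compat_blk_nrelated p q : compat p (blk q) -> p != q ->
  (nrelated p < nrelated q)%N.
Proof.
move=> /compatP pq p_neq_q; apply: proper_card; apply/properP; split.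
  by apply/subsetP => -[u v]; rewrite !inE => /eqP/pq/eqP.
apply/exists_inP; apply: contraNT p_neq_q => /exists_inPn qp.
rewrite -(kerdiag_blk p) -(kerdiag_blk q); apply/eqP/eq_kerdiag => u v.
apply/eqP/eqP => [/pq //|quv]; apply/eqP/negPn.
by apply: (qp (u, v)); rewrite inE quv.
Qed.

(** Each vertex is labelled by the position of the first vertex of its block, so 2r letters are
    enough. *)
Lemma exists_kerdiag n p : (2 * r <= n)%N -> exists f : vertex r -> 'I_n, kerdiag f = p.
Proof.
move=> le_n; have lt_n u : (index (blk p u) (codom (blk p)) < n)%N.
  apply: leq_trans le_n; rewrite mul2n -addnn -[X in (X + X)%N]card_ord -card_sum.
  by rewrite -(size_codom (blk p)) index_mem codom_f.
exists (fun u => Ordinal (lt_n u)); rewrite -[RHS]kerdiag_blk; apply: eq_kerdiag => u v.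
rewrite -val_eqE /=; apply/eqP/eqP => [uv|-> //].
by rewrite -(nth_index (blk p u) (codom_f (blk p) u)) uv nth_index ?codom_f.
Qed.

End Refinement.

(** * Composition of diagrams *)

Section Stacking.
Variables (r n : nat).
Notation word := {ffun 'I_r -> 'I_n}.
Implicit Types (p q : setpart r) (v u w : word).

Definition glue v w (x : vertex r) : 'I_n :=
  match x with inl i => v i | inr i => w i end.

Definition glue3 v u w (x : stacked r) : 'I_n :=
  match x with inl y => glue v u y | inr i => w i end.

Lemma glue3_lower v u w x : glue3 v u w (lower x) = glue u w x.
Proof. by case: x. Qed.

Lemma glue3_outer v u w x : glue3 v u w (outer x) = glue v w x.
Proof. by case: x. Qed.

(** Constancy along edges propagates along paths, so compatibility with both diagrams is constancy
    on the components of the stacked graph. *)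
Lemma glue3P p q v u w :
  reflect (forall x y, stack_conn p q x y -> glue3 v u w x = glue3 v u w y)
          (compat p (glue v u) && compat q (glue u w)).
Proof.
apply: (iffP andP) => [[/compat_blocksP pP /compat_blocksP qP] x y|conn].
  have adj x' y' : stack_adj p q x' y' -> glue3 v u w x' = glue3 v u w y'.
    case/orP=> /exists_inP[B Bp /andP[/imsetP[a aB ->] /imsetP[b bB ->]]].
      exact: pP Bp aB bB.
    by rewrite !glue3_lower; exact: qP Bp aB bB.
  case/connectP=> s; elim: s x => [|z s IHs] x /= => [_ -> //|/andP[/adj-> zs]].
  exact: IHs.
split; apply/compat_blocksP => B x y Bp xB yB.
  apply: (conn (upper x) (upper y)); apply: connect1; apply/orP; left.
  by apply/exists_inP; exists B; rewrite ?imset_f.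
rewrite -!(glue3_lower v); apply: conn; apply: connect1; apply/orP; right.
by apply/exists_inP; exists B; rewrite ?imset_f.
Qed.

Lemma blk_comp_diag p q x y :
  (blk (comp_diag p q) x == blk (comp_diag p q) y)
  = stack_conn p q (outer x) (outer y).
Proof.
have eqv := stack_conn_equiv p q.
rewrite -(mem_blk _ (blk_mem _ y)) /blk /= pblock_equivalence_partition ?inE //.
  have csym a b : stack_conn p q a b -> stack_conn p q b a.
    by move=> ab; have [aa /(_ ab) <-] := eqv a b a.
  by apply/idP/idP; exact: csym.
Qed.

(* A compatible middle row is forced on the components that reach the outer rows,
   and amounts to one free letter for each component of the middle row. *)
Lemma card_middle_words p q v w :
  #|[pred u | compat p (glue v u) && compat q (glue u w)]|
  = (n ^ nmiddle p q * compat (comp_diag p q) (glue v w))%N.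
Proof.
have eqv := stack_conn_equiv p q.
have crefl x : stack_conn p q x x by have [] := eqv x x x.
have csym x y : stack_conn p q x y -> stack_conn p q y x.
  by move=> xy; have [_ /(_ xy) <-] := eqv x y x.
have [/compatP cvw|/compatP cvw] := boolP (compat _ (glue v w)); last first.
  rewrite muln0; apply: eq_card0 => u; apply/negP => /glue3P conn; apply: cvw => x y.
  by move/eqP; rewrite blk_comp_diag => /conn; rewrite !glue3_outer.
rewrite muln1; pose cls x := [set y | stack_conn p q x y].
have clsE x y : stack_conn p q x y -> cls x = cls y.
  by move=> xy; apply/setP => z; rewrite !inE; have [_ /(_ xy)] := eqv x y z.
pose K := [set C in equivalence_partition (stack_conn p q) [set: stacked r]
            | C \subset middle_row r].
have KE x : (cls x \in K) = (cls x \subset middle_row r).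
  rewrite inE andbC; case: (_ \subset _) => //=; apply/imsetP; exists x; rewrite ?inE //.
  by apply/setP => y; rewrite !inE.
pose mid (i : 'I_r) : stacked r := inl (inr i).
have KP C : C \in K -> exists i, C == cls (mid i).
  rewrite inE => /andP[/imsetP[x _ ->] /subsetP sub].
  have /sub /imsetP[i _ xE] : x \in [set y in [set: stacked r] | stack_conn p q x y].
    by rewrite inE in_setT crefl.
  by exists i; apply/eqP/setP => y; rewrite !inE xE.
pose T := {C : {set stacked r} | C \in K}.
(* A component inside the middle row takes its free letter from [h]; any other one takes the letter
   of some outer vertex, whose choice is immaterial by [cvw]. *)
pose valc (h : {ffun T -> 'I_n}) C : option 'I_n :=
  if insub C is Some D then Some (h D)
  else omap (glue v w) [pick z | outer z \in C].
(* A middle vertex whose component leaves the middle row is connected to an outer row, so [valc] has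
   a value there and [w i] is a formal default. *)
pose Psi h : word := [ffun i => odflt (w i) (valc h (cls (mid i)))].
have valcE h x : Some (glue3 v (Psi h) w x) = valc h (cls x).
  have outE z : Some (glue v w z) = valc h (cls (outer z)).
    rewrite /valc insubN; last first.
      rewrite KE; apply/subsetPn; exists (outer z); first by rewrite inE.
      by apply/imsetP => -[i _]; case: z.
    case: pickP => [z' /=|/(_ z)]; rewrite inE ?crefl //.
    by rewrite -blk_comp_diag => /eqP /cvw ->.
  case: x => [[i|i]|i]; [exact: (outE (inl i)) | | exact: (outE (inr i))].
  rewrite /= ffunE; suff: isSome (valc h (cls (mid i))) by case: (valc h _).
  rewrite /valc; case: insubP => //= /negPf; rewrite KE => /negbT/subsetPn[y].
  rewrite inE => iy yN; case: pickP => // /(_ _).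
  case: y iy yN => [[j|j]|j] iy yN.
  - by move/(_ (inl j)); rewrite inE iy.
  - by case/negP: yN; apply/imsetP; exists j.
  - by move/(_ (inr j)); rewrite inE iy.
have Psi_inj : injective Psi.
  move=> h1 h2 /ffunP h12; apply/ffunP => C; have [i /eqP Ci] := KP _ (valP C).
  have := h12 i; rewrite !ffunE /valc -Ci valK.
  by [].
have -> : nmiddle p q = #|{: T}| by rewrite card_sig; apply: eq_card => C; rewrite !inE.
rewrite -[in RHS](card_ord n) -card_ffun -(card_imset _ Psi_inj); apply: eq_card => u.
rewrite inE; apply/glue3P/imsetP => [conn|[h _ ->] x y xy]; last first.
  by apply: Some_inj; rewrite !valcE (clsE _ _ xy).
exists [ffun C : T => u (xchoose (KP _ (valP C)))] => //; apply/ffunP => i.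
have iE : Some (u i) = valc [ffun C : T => u (xchoose (KP _ (valP C)))] (cls (mid i)).
  rewrite /valc; case: insubP => [C CK CE|CN].
    rewrite ffunE; congr Some; have := xchooseP (KP _ (valP C)).
    move: (xchoose _) => j; rewrite CE => /eqP/setP/(_ (mid j)); rewrite !inE crefl => cc.
    exact: (conn (mid i) (mid j) cc).
  case: pickP => [z|noz].
    by rewrite inE => /conn; rewrite glue3_outer => /= <-.
  case/negP: CN; rewrite KE; apply/subsetP => -[[j|j]|j] jc.
  - by have := noz (inl j); rewrite jc.
  - by apply/imsetP; exists j.
  - by have := noz (inr j); rewrite jc.
by rewrite ffunE -iE.
Qed.

End Stacking.

(** * The tensor representation of the partition algebra *)

Section DiagramMatrices.
Variables (F : fieldType) (r : nat).
Implicit Types (p q : setpart r) (phi psi : palg F r).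

(* For f = glue v w this is the (v, w) entry of the matrix of phi on tensors. *)
Definition tmx (T : eqType) (f : vertex r -> T) phi : F :=
  \sum_p phi p * (compat p f)%:R.

Lemma tmx_is_linear (T : eqType) (f : vertex r -> T) : linear (tmx f : palg F r -> F^o).
Proof.
move=> c x y; rewrite /tmx scaler_sumr -big_split; apply: eq_bigr => p _ /=.
by rewrite !ffunE mulrDl /GRing.scale /= mulrA.
Qed.

HB.instance Definition _ (T : eqType) (f : vertex r -> T) :=
  GRing.isLinear.Build F (palg F r) F^o *:%R (tmx f) (tmx_is_linear f).

Lemma tmxZ (T : eqType) (f : vertex r -> T) c phi : tmx f (c *: phi) = c * tmx f phi.
Proof. exact: linearZ. Qed.

Lemma tmx_sum (T : eqType) (f : vertex r -> T) (I : Type) (s : seq I)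
    (P : pred I) (G : I -> palg F r) :
  tmx f (\sum_(i <- s | P i) G i) = \sum_(i <- s | P i) tmx f (G i).
Proof. exact: linear_sum. Qed.

Lemma eq_tmx (T : eqType) (f f' : vertex r -> T) phi : f =1 f' -> tmx f phi = tmx f' phi.
Proof. by move=> ff'; apply: eq_bigr => p _; rewrite (eq_compat _ ff'). Qed.

Lemma tmx_kerdiag (T : eqType) (f : vertex r -> T) phi :
  tmx f phi = tmx (blk (kerdiag f)) phi.
Proof. by apply: eq_bigr => p _; rewrite compat_kerdiag. Qed.

Lemma tmx_diag (T : eqType) (f : vertex r -> T) p : tmx f (Ldiag F p) = (compat p f)%:R.
Proof.
rewrite /tmx (bigD1 p) //= big1 ?addr0 ?ffunE ?eqxx ?mul1r // => q /negbTE qp.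
by rewrite ffunE qp mul0r.
Qed.

(** The entry at [q] only involves the [p] refining [q]. By induction on [nrelated], the strictly
    finer coefficients vanish and the entry reduces to [phi q]. *)
Lemma tmx_blk_inj phi : (forall q, tmx (blk q) phi = 0) -> phi = 0.
Proof.
move=> phi0; apply/ffunP => q; rewrite [RHS]ffunE.
have [N le_qN] := ubnP (nrelated q); elim: N => // N IHN in q le_qN *.
have := phi0 q; rewrite /tmx (bigD1 q) //= big1 ?addr0.
  by move=> <-; rewrite (_ : compat q (blk q)) ?mulr1 //; apply/compatP.
move=> p p_neq_q; have [pq|_] := boolP (compat p _); last by rewrite mulr0.
rewrite IHN ?mul0r //; apply: leq_trans (compat_blk_nrelated pq p_neq_q) _.
by rewrite -ltnS.
Qed.

(** The zeta transform of the refinement order: the value at [q] is the sum of [phi p] over the [p]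
    refining [q]. *)
Definition zeta phi : palg F r := [ffun q => tmx (blk q) phi].

Lemma zeta_is_linear : linear zeta.
Proof. by move=> c x y; apply/ffunP => q; rewrite !ffunE linearP. Qed.

HB.instance Definition _ :=
  GRing.isLinear.Build F (palg F r) (palg F r) *:%R zeta zeta_is_linear.

(** An injective endomorphism of a finite-dimensional space is onto. *)
Lemma tmx_blk_surj (N : setpart r -> F) : exists phi, forall q, tmx (blk q) phi = N q.
Proof.
have ker0 : lker (linfun zeta) == 0%VS.
  apply/lker0P => x y; rewrite !lfunE /= => Gxy; apply/eqP; rewrite -subr_eq0; apply/eqP.
  apply: tmx_blk_inj => q; rewrite linearB /=.
  by have /ffunP/(_ q) := Gxy; rewrite !ffunE => ->; rewrite subrr.
have := memvf ([ffun q => N q] : palg F r); rewrite -(lker0_limgf ker0).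
case/memv_imgP=> phi _; rewrite lfunE /= => /ffunP NG; exists phi => q.
by have := NG q; rewrite !ffunE.
Qed.

Variable n : nat.
Notation word := {ffun 'I_r -> 'I_n}.
Implicit Types (v w : word).

Lemma glue_surj (f : vertex r -> 'I_n) : exists v w, f =1 glue v w.
Proof.
exists [ffun i => f (inl i)], [ffun i => f (inr i)].
by case=> i; rewrite /= ffunE.
Qed.

(** By [card_middle_words], the power of n in the product of two diagrams counts the compatible
    middle words. *)
Lemma tmx_pmul phi psi v w :
  tmx (glue v w) (pmul n phi psi)
  = \sum_(u : word) tmx (glue v u) phi * tmx (glue u w) psi.
Proof.
rewrite /pmul linear_sum; transitivity (\sum_p \sum_q \sum_(u : word)
  phi p * (compat p (glue v u))%:R * (psi q * (compat q (glue u w))%:R)); last first.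
  under [RHS]eq_bigr do rewrite /tmx big_distrlr /=.
  by rewrite [RHS]exchange_big; apply: eq_bigr => p _; rewrite [RHS]exchange_big.
apply: eq_bigr => p _; rewrite linear_sum; apply: eq_bigr => q _ /=.
transitivity (phi p * psi q
    * #|[pred u | compat p (glue v u) && compat q (glue u w)]|%:R).
  by rewrite card_middle_words natrM natrX mulrA linearZ /= tmx_diag.
rewrite -sum1_card natr_sum big_mkcond mulr_sumr; apply: eq_bigr => u _.
rewrite inE; case: (compat p _) (compat q _) => [] [];
  by rewrite ?mulr1 ?mulr0 ?mul0r.
Qed.

(** * Faithfulness and image of the representation for n at least 2r *)

Hypothesis n_ge2r : (2 * r <= n)%N.

Lemma tmx_inj phi psi :
  (forall v w, tmx (glue v w) phi = tmx (glue v w) psi) -> phi = psi.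
Proof.
move=> phipsi; apply/eqP; rewrite -subr_eq0; apply/eqP/tmx_blk_inj => q.
have [f <-] := exists_kerdiag q n_ge2r; have [v [w fE]] := glue_surj f.
by rewrite -tmx_kerdiag (eq_tmx _ fE) linearB /= phipsi subrr.
Qed.

(** Send each letter to its fibre, a set of vertices. The nonempty fibres are the blocks of the
    common kernel, each attached to a single letter, so both fibre maps have the same counts and a
    permutation matches them. *)
Lemma exists_perm_kerdiag (f g : vertex r -> 'I_n) :
  kerdiag f = kerdiag g -> exists s : 'S_n, forall u, s (f u) = g u.
Proof.
move=> fg; have fgE x y : (f x == f y) = (g x == g y).
  by rewrite -(blk_kerdiag f) -(blk_kerdiag g) fg.
pose fib (h : vertex r -> 'I_n) j := [set u | h u == j].
have [C|s sE] := @exists_perm_with_counts _ _ (fib f) (fib g); last first.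
  exists s => u; have : u \in fib f (f u) by rewrite inE.
  by rewrite -sE inE => /eqP.
have count1 h C0 : C0 != set0 ->
    #|[pred j | fib h j == C0]| = [exists u, C0 == fib h (h u)].
  move=> /set0Pn[u uC]; case: existsP => [[u' /eqP ->]|noC].
    apply: (@eq_card1 _ (h u')) => j; rewrite !inE; apply/eqP/eqP => [|->//].
    by move/setP/(_ u'); rewrite !inE eqxx => /eqP ->.
  apply: eq_card0 => j; rewrite inE; apply/negP => /eqP jC; case: noC; exists u.
  by move: uC; rewrite -jC inE => /eqP ->.
have cnt C0 : C0 != set0 -> #|[pred j | fib f j == C0]| = #|[pred j | fib g j == C0]|.
  move=> C0n; rewrite !count1 //; congr (nat_of_bool _); apply: eq_existsb => u.
  by congr (_ == _); apply/setP => x; rewrite !inE fgE.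
(* The letters missed by f and those missed by g are equinumerous too. *)
have [->|/cnt //] := eqVneq C set0.
have total h : (#|[pred j | fib h j == set0]|
    + \sum_(C0 : {set vertex r} | C0 != set0) #|[pred j | fib h j == C0]|)%N = n.
  transitivity (\sum_(C0 : {set vertex r}) #|[pred j | fib h j == C0]|)%N.
    by rewrite [RHS](bigD1 set0).
  rewrite -[RHS](card_ord n) -[RHS]sum1_card (partition_big (fib h) xpredT) //=.
  by apply: eq_bigr => C0 _; rewrite -sum1_card; apply: eq_bigl => j; rewrite inE.
apply/eqP; rewrite -(eqn_add2r
  (\sum_(C0 : {set vertex r} | C0 != set0) #|[pred j | fib g j == C0]|)).
rewrite total -[X in _ == X](total f) eqn_add2l; apply/eqP/esym.
by apply: eq_bigr => C0 /cnt.
Qed.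

(** Pairs of words with equal kernels lie in one orbit of ['S_n], so an invariant [N] is a function
    of the kernel and [tmx_blk_surj] applies. *)
Lemma tmx_surj (N : word -> word -> F) :
    (forall (s : 'S_n) v w, N [ffun i => s (v i)] [ffun i => s (w i)] = N v w) ->
  exists phi, forall v w, tmx (glue v w) phi = N v w.
Proof.
move=> Ninv.
pose Nf (f : vertex r -> 'I_n) := N [ffun i => f (inl i)] [ffun i => f (inr i)].
have NfE v w : Nf (glue v w) = N v w.
  by congr N; apply/ffunP => i; rewrite ffunE.
have real q : exists f : {ffun vertex r -> 'I_n}, kerdiag f == q.
  have [f fq] := exists_kerdiag q n_ge2r; exists (finfun f).
  by rewrite -fq; apply/eqP/eq_kerdiag => x y; rewrite !ffunE.
have [phi phiE] := tmx_blk_surj (fun q => Nf (xchoose (real q))).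
exists phi => v w; rewrite tmx_kerdiag phiE -NfE.
have /eqP := xchooseP (real (kerdiag (glue v w))).
move: (xchoose _) => f /exists_perm_kerdiag[s sE].
rewrite /Nf -(Ninv s); congr N; apply/ffunP => i; rewrite !ffunE -sE //.
Qed.

End DiagramMatrices.

(** Used to list the blocks of a diagram in the order in which their painted images occur in a
    multiset partition. *)
Lemma perm_map_lift (T S : eqType) (x0 : T) (F : T -> S) (s : seq S) (t : seq T) :
  perm_eq s (map F t) -> exists2 t', perm_eq t' t & s = map F t'.
Proof.
case/(perm_iotaP (F x0)) => Is; rewrite size_map => IsP ->.
exists (map (nth x0 t) Is); first by rewrite -[X in perm_eq _ X](mkseq_nth x0) perm_map.
rewrite -map_comp; apply/eq_in_map => i.
rewrite (perm_mem IsP) mem_iota => /andP[_ lt_i] /=.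
by rewrite (nth_map x0).
Qed.

(** * The coloring map *)

Section Coloring.
Variables r k : nat.
Implicit Types (a b c : wcomp r k) (s : 'S_r) (p q : setpart r) (m : mpart r k).

Lemma itv_of_inj a t j j' : t \in itv_of a j -> t \in itv_of a j' -> j = j'.
Proof.
wlog lt_jj : j j' / (j < j')%N => [th|].
  by case: (ltngtP j j') => [/th|/th th' tj tj'|/val_inj //]; last by rewrite th'.
rewrite !inE => /andP[_ tj] /andP[tj' _]; have := leq_ltn_trans tj' tj.
rewrite ltnNge big_mkcond [X in (_ <= X)%N]big_mkcond leq_sum // => l _.
by case: (leqP l j) => // /leq_ltn_trans ->.
Qed.

Lemma colorE a t j : (color a t == j) = (t \in itv_of a j).
Proof.
have ct : t \in itv_of a (color a t) := xchooseP (color_proof a t).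
by apply/eqP/idP => [<- //|]; apply: itv_of_inj.
Qed.

Lemma card_color a j : #|[pred t | color a t == j]| = val a j.
Proof.
pose lo := (\sum_(l < k | l < j) val a l)%N.
have hiE : (\sum_(l < k | l <= j) val a l = lo + val a j)%N.
  rewrite (bigD1 j) //= addnC; congr (_ + _)%N; apply: eq_bigl => l.
  by rewrite ltn_neqAle andbC.
have hi_r : (lo + val a j <= r)%N.
  rewrite -hiE -[X in (_ <= X)%N](eqP (valP a)).
  by rewrite [X in (_ <= X)%N](bigID (fun l : 'I_k => l <= j)%N) leq_addr.
pose f (i : 'I_(val a j)) : 'I_r := widen_ord hi_r (rshift lo i).
have f_inj : injective f by move=> i i' /(congr1 val) /= /addnI /val_inj.
rewrite -[RHS]card_ord -(card_image f_inj); apply: eq_card => t.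
rewrite [LHS]inE colorE inE hiE; apply/andP/imageP => [[lo_t t_hi]|[i _ ->]].
  have lt_t : (t - lo < val a j)%N by rewrite ltn_subLR.
  by exists (Ordinal lt_t) => //; apply: val_inj; rewrite /= subnKC.
by rewrite /= leq_addr ltn_add2l.
Qed.

Lemma youngP a s : reflect (forall t, color a (s t) = color a t) (s \in young a).
Proof.
apply: (iffP bigcapP) => [sP t|sP j _].
  apply/eqP; rewrite colorE; have stE : (s t \in itv_of a (color a t)) = _ :=
    astabs_act t (sP (color a t) isT).
  by rewrite stE -colorE.
by apply/astabsP => t; rewrite -!colorE -(sP t).
Qed.

Lemma young1 a : 1%g \in young a.
Proof. by apply/youngP => t; rewrite perm1. Qed.

Lemma youngV a s : (s^-1%g \in young a) = (s \in young a).
Proof.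
have sub s' : s' \in young a -> s'^-1%g \in young a.
  by move/youngP=> sP; apply/youngP => t; rewrite -sP permKV.
by apply/idP/idP => [/sub|/sub //]; rewrite invgK.
Qed.

Lemma youngMl a s s' : s \in young a -> ((s * s')%g \in young a) = (s' \in young a).
Proof.
move/youngP => sP; apply/youngP/youngP => sP' t; last by rewrite permM sP' sP.
by rewrite -[t](permKV s) -permM sP' sP.
Qed.

Lemma card_young_gt0 a : (0 < #|young a|)%N.
Proof. by apply/card_gt0P; exists 1%g; exact: young1. Qed.

Lemma card_paint a b x :
  #|[pred u | paint a b u == x]| = match x with inl j => val a j | inr j => val b j end.
Proof.
rewrite -sum1_card big_mkcond big_sumType /=.
case: x => j.
  rewrite [X in (_ + X)%N]big1 ?addn0 // -card_color -[RHS]sum1_card [RHS]big_mkcond.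
  by apply: eq_bigr => i _; rewrite !inE /= (inj_eq inl_inj).
rewrite [X in (X + _)%N]big1 ?add0n // -card_color -[RHS]sum1_card [RHS]big_mkcond.
by apply: eq_bigr => i _; rewrite !inE /= (inj_eq inr_inj).
Qed.

(** [h] sends a vertex to the position of its block in the sequence underlying [m]; the counts say
    that the fibre over [i], once painted, is the block at position [i]. *)
Definition block_counts a b m (h : vertex r -> 'I_(size (val m))) :=
  forall x i, #|[pred u | (paint a b u == x) && (h u == i)]| = nth mset0 (val m) i x.

Lemma mcountE m x : mcount (val m) x = (\sum_(i < size (val m)) nth mset0 (val m) i x)%N.
Proof. by rewrite /mcount (big_nth mset0) big_mkord. Qed.

Lemma block_counts_mult a b m (h : vertex r -> 'I_(size (val m))) :
  block_counts a b h -> a = umult m /\ b = bmult m.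
Proof.
move=> hP.
have cnt x : mcount (val m) x = #|[pred u | paint a b u == x]|.
  rewrite mcountE -[RHS]sum1_card (partition_big h xpredT) //=; apply: eq_bigr => i _.
  by rewrite -hP -sum1_card; apply: eq_bigl => u; rewrite !inE.
split; apply: val_inj; apply/ffunP => j; apply: val_inj.
  by rewrite [RHS]umultE cnt card_paint.
by rewrite [RHS]bmultE cnt card_paint.
Qed.

Lemma exists_block_counts m :
  exists h : vertex r -> 'I_(size (val m)), block_counts (umult m) (bmult m) h.
Proof.
apply: exists_fun_with_counts => x; rewrite -mcountE card_paint.
by case: x => j; rewrite ?umultE ?bmultE.
Qed.

Lemma nth_mpart_neq0 m i : (i < size (val m))%N -> nth mset0 (val m) i != mset0.
Proof.
move=> lt_i; apply: contraTneq (valP m) => i0.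
by rewrite /is_mpart -[in X in X \notin _]i0 mem_nth.
Qed.

Definition paint_block a b (B : {set vertex r}) : {mset vertex k}%mset :=
  seq_mset [seq paint a b u | u <- enum B].

Lemma paint_blockE a b B x :
  paint_block a b B x = #|[pred u | (paint a b u == x) && (u \in B)]|.
Proof.
rewrite mset_seqE count_map -sum1_count big_enum_cond /= -sum1_card.
by apply: eq_bigl => u; rewrite !inE andbC.
Qed.

(** Replaces an equality of multisets of multisets by fibre counts of a labelling, to which the
    existence lemmas on functions and permutations apply. *)
Lemma kappaP a b p m :
  kappa a b p = m <->
  exists2 h : vertex r -> 'I_(size (val m)), p = kerdiag h & block_counts a b h.
Proof.
split=> [mE|[h -> hP]].
  have := perm_eq_seq_mset [seq paint_block a b B | B <- enum (val p)].
  rewrite -[X in perm_eq X _]/(val (kappa a b p) : seq _) mE.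
  (* [e] lists the blocks of [p] in the order of the blocks of [m] that they paint to; a vertex is
     labelled by the position of its block. *)
  case/(perm_map_lift set0) => e e_p mF.
  have lt_e u : (index (blk p u) e < size (val m))%N.
    by rewrite mF size_map index_mem (perm_mem e_p) mem_enum blk_mem.
  have e_blk u : blk p u \in e by rewrite (perm_mem e_p) mem_enum blk_mem.
  exists (fun u => Ordinal (lt_e u)).
    rewrite -[LHS]kerdiag_blk; apply: eq_kerdiag => u v; rewrite -[in RHS]val_eqE /=.
    apply/eqP/eqP => [->//|uv].
    by rewrite -(nth_index set0 (e_blk u)) uv nth_index.
  move=> x i; have lt_i : (i < size e)%N by rewrite -(size_map (paint_block a b)) -mF.
  have nth_e : nth set0 e i \in val p by rewrite -mem_enum -(perm_mem e_p) mem_nth.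
  transitivity (paint_block a b (nth set0 e i) x).
    rewrite paint_blockE; apply: eq_card => u; rewrite !inE (mem_blk _ nth_e).
    congr (_ && _); rewrite -val_eqE /=; apply/eqP/eqP => [<-|uE].
      by rewrite nth_index.
    by rewrite uE index_uniq // (perm_uniq e_p) enum_uniq.
  by rewrite -(nth_map set0 mset0) // -mF.
apply: val_inj; rewrite /= /paint_diag -[RHS]seq_mset_id; apply/eq_seq_msetP.
pose fib i := [set u | h u == i].
have fibE i : paint_block a b (fib i) = nth mset0 (val m) i.
  apply/msetP => x; rewrite paint_blockE -hP; apply: eq_card => u.
  by rewrite !inE.
(* The blocks of [m] are nonempty, so every label occurs; hence distinct labels have distinct
   fibres. *)
have fib_n0 i : exists u, h u = i.
  have := nth_mpart_neq0 (ltn_ord i).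
  case: (pickP [pred u | h u == i]) => [u /eqP <-|noh].
    by exists u.
  case/eqP; apply/msetP => x; rewrite -hP mset0E; apply: eq_card0 => u.
  by have := noh u; rewrite !inE => ->; rewrite andbF.
have fib_inj : injective fib.
  move=> i i'; have [u <-] := fib_n0 i; move/setP/(_ u).
  by rewrite !inE eqxx => /esym/eqP.
have enumE : perm_eq (enum (val (kerdiag h))) [seq fib i | i <- enum 'I_(size (val m))].
  apply: uniq_perm; [exact: enum_uniq | by rewrite map_inj_uniq ?enum_uniq | move=> B].
  rewrite mem_enum; apply/imsetP/mapP => [[u _ ->]|[i _ ->]].
    exists (h u); rewrite ?mem_enum //; apply/setP => v; rewrite !inE eq_sym //.
  have [u <-] := fib_n0 i; exists u; rewrite ?inE //.
  by apply/setP => v; rewrite !inE eq_sym.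
apply: perm_trans (perm_map _ enumE) _; rewrite -map_comp.
rewrite (eq_map (g := fun i : 'I_(size (val m)) => nth mset0 (val m) i)) //.
by rewrite (map_comp (nth mset0 (val m)) val) val_enum_ord map_nth_iota0 // take_size.
Qed.

Lemma kappa_mult a b p : umult (kappa a b p) = a /\ bmult (kappa a b p) = b.
Proof.
by have [/(_ erefl)[h _ /block_counts_mult[<- <-]] _] := kappaP a b p (kappa a b p).
Qed.

Lemma kappa_surj m : exists p, kappa (umult m) (bmult m) p = m.
Proof.
by have [h hP] := exists_block_counts m; exists (kerdiag h); apply/kappaP; exists h.
Qed.

(** * Pairs of permutations acting on diagrams, and the fibres of the coloring map *)

Definition vperm s s' (u : vertex r) : vertex r :=
  match u with inl i => inl (s i) | inr i => inr (s' i) end.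

(** The blocks are the images under [vperm s s'] of those of [p]; as a kernel this is expressed by
    pulling back, hence the inverses. *)
Definition vact s s' p : setpart r := kerdiag (blk p \o vperm s^-1 s'^-1).

Lemma vpermK s s' : cancel (vperm s s') (vperm s^-1 s'^-1).
Proof. by case=> i /=; rewrite permK. Qed.

Lemma vpermKV s s' : cancel (vperm s^-1 s'^-1) (vperm s s').
Proof. by case=> i /=; rewrite permKV. Qed.

Lemma paint_vperm a b s s' u : s \in young a -> s' \in young b ->
  paint a b (vperm s s' u) = paint a b u.
Proof. by move=> /youngP sP /youngP sP'; case: u => i /=; rewrite ?sP ?sP'. Qed.

Lemma compat_vact (T : eqType) s s' p (f : vertex r -> T) :
  compat (vact s s' p) f = compat p (f \o vperm s s').
Proof.
apply/compatP/compatP => fP u v.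
  move=> uv; apply: fP; apply/eqP; rewrite blk_kerdiag /= !vpermK; exact/eqP.
move/eqP; rewrite blk_kerdiag /= => /eqP /fP /=.
by rewrite !vpermKV.
Qed.

Lemma kappa_vact a b s s' p : s \in young a -> s' \in young b ->
  kappa a b (vact s s' p) = kappa a b p.
Proof.
move=> sa sb; have [/(_ erefl)[h pE hP] _] := kappaP a b p (kappa a b p).
apply/kappaP; exists (h \o vperm s^-1 s'^-1).
  by apply: eq_kerdiag => u v /=; rewrite {1 2}pE blk_kerdiag.
move=> x i; rewrite -hP.
have v_inj : injective (vperm s s') by exact: can_inj (vpermK s s').
rewrite -[RHS](card_image v_inj); apply: eq_card => u.
rewrite -[u](vpermKV s s') mem_image // !inE /= vpermK.
by rewrite (paint_vperm _ sa sb).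
Qed.

Lemma block_counts_inl a b m (h : vertex r -> 'I_(size (val m))) : block_counts a b h ->
  forall x, #|[pred t | (color a t, h (inl t)) == x]| = nth mset0 (val m) x.2 (inl x.1).
Proof.
move=> hP x; rewrite -hP -[RHS]sum1_card big_mkcond big_sumType /=.
rewrite [X in (_ + X)%N]big1 ?addn0 => [|//].
rewrite -[LHS]sum1_card [LHS]big_mkcond; apply: eq_bigr => t _.
by rewrite !inE /= (inj_eq inl_inj); case: x.
Qed.

Lemma block_counts_inr a b m (h : vertex r -> 'I_(size (val m))) : block_counts a b h ->
  forall x, #|[pred t | (color b t, h (inr t)) == x]| = nth mset0 (val m) x.2 (inr x.1).
Proof.
move=> hP x; rewrite -hP -[RHS]sum1_card big_mkcond big_sumType /=.
rewrite [X in (X + _)%N]big1 ?add0n => [|//].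
rewrite -[LHS]sum1_card [LHS]big_mkcond; apply: eq_bigr => t _.
by rewrite !inE /= (inj_eq inr_inj); case: x.
Qed.

(** Both diagrams are kernels of labellings by positions in the same multiset partition. Row by row
    the pairs (colour, position) have the same counts, so permutations match them; preserving
    colours, these lie in the Young subgroups. *)
Lemma kappa_eq_vact a b p q : kappa a b p = kappa a b q ->
  exists s s', [/\ s \in young a, s' \in young b & q = vact s s' p].
Proof.
move=> pq; have [/(_ pq)[h pE hP] _] := kappaP a b p (kappa a b q).
have [/(_ erefl)[h' qE hP'] _] := kappaP a b q (kappa a b q).
have [x|s sE] := @exists_perm_with_counts _ _
    (fun t => (color a t, h (inl t))) (fun t => (color a t, h' (inl t))).
  by rewrite (block_counts_inl hP) (block_counts_inl hP').
have [x|s' sE'] := @exists_perm_with_counts _ _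
    (fun t => (color b t, h (inr t))) (fun t => (color b t, h' (inr t))).
  by rewrite (block_counts_inr hP) (block_counts_inr hP').
exists s, s'; split.
- by apply/youngP => t; have [] := sE t.
- by apply/youngP => t; have [] := sE' t.
have h'E u : h' (vperm s s' u) = h u.
  by case: u => t /=; [have [] := sE t | have [] := sE' t].
rewrite qE; apply: eq_kerdiag => u v /=; rewrite pE blk_kerdiag -!h'E.
by rewrite !vpermKV.
Qed.

End Coloring.

(** * The painted algebra *)

Section PaintedAlgebra.
Variables (F : fieldType) (r k n : nat).
Notation word := {ffun 'I_r -> 'I_n}.
Notation palg := (palg F r).
Notation Ldiag := (Ldiag F).
Notation symm := (symm F).
Implicit Types (a b c : wcomp r k) (s : 'S_r) (p q : setpart r) (v u w : word).
Implicit Types (phi psi : palg) (m : mpart r k).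

HB.instance Definition _ phi :=
  GRing.isLinear.Build F palg palg *:%R (pmul n phi) (pmul_linearr n phi).

Definition pmulr psi phi := pmul n phi psi.

HB.instance Definition _ psi :=
  GRing.isLinear.Build F palg palg *:%R (pmulr psi) (pmul_linearl n psi).

Definition wact v s : word := [ffun i => v (s i)].

(** Products in ['S_r] apply the left factor first, which reverses the order here. *)
Lemma wactM v s s' : wact (wact v s) s' = wact v (s' * s)%g.
Proof. by apply/ffunP => i; rewrite !ffunE permM. Qed.

Lemma wactK v s : wact (wact v s) s^-1%g = v.
Proof. by apply/ffunP => i; rewrite !ffunE permKV. Qed.

Lemma wactKV v s : wact (wact v s^-1%g) s = v.
Proof. by apply/ffunP => i; rewrite !ffunE permK. Qed.

Lemma glue_vperm v w s s' : glue v w \o vperm s s' =1 glue (wact v s) (wact w s').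
Proof. by case=> i; rewrite /= ffunE. Qed.

Lemma glue_relabel v w s : glue v w \o relabel s =1 glue (wact v s) w.
Proof. by case=> i; rewrite /= ?ffunE. Qed.

Lemma compat_act_diag (T : eqType) s p (f : vertex r -> T) :
  compat (act_diag s p) f = compat p (f \o relabel s).
Proof.
apply/compat_blocksP/compat_blocksP => fP B u v Bp.
  by move=> uB vB; apply: (fP (relabel s @: B)); rewrite ?imset_f.
by case/imsetP: Bp => {}B Bp -> /imsetP[x xB ->] /imsetP[y yB ->]; exact: fP xB yB.
Qed.

Lemma compat_perm_diag v w s : compat (perm_diag s) (glue v w) = (wact v s == w).
Proof.
apply/compat_blocksP/eqP => [vw|<- B u u' /imsetP[i _ ->]].
  apply/ffunP => i; rewrite ffunE; apply: (vw [set inl (s i); inr i] (inl (s i)) (inr i)).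
  - exact: imset_f.
  - by rewrite !inE eqxx.
  - by rewrite !inE eqxx orbT.
by rewrite !inE => /orP[] /eqP-> /orP[] /eqP-> //=; rewrite ffunE.
Qed.

Lemma LdiagE p q : Ldiag p q = (q == p)%:R.
Proof. by rewrite ffunE. Qed.

Lemma summand_injE a b phi ab : summand_inj a b phi ab = if ab == (a, b) then phi else 0.
Proof. by rewrite ffunE. Qed.

Lemma symmE a : symm a = #|young a|%:R^-1 *: \sum_(s in young a) Ldiag (perm_diag s).
Proof. by []. Qed.

Lemma sandwichE a b phi : sandwich n a b phi = pmul n (pmul n (symm a) phi) (symm b).
Proof. by []. Qed.

Lemma tmx_symm a v w :
  tmx (glue v w) (symm a) = #|young a|%:R^-1 * \sum_(s in young a) (wact v s == w)%:R.
Proof.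
rewrite symmE tmxZ tmx_sum; congr (_ * _); apply: eq_bigr => s _.
by rewrite tmx_diag compat_perm_diag.
Qed.

Lemma tmx_symml a phi v w :
  tmx (glue v w) (pmul n (symm a) phi)
  = #|young a|%:R^-1 * \sum_(s in young a) tmx (glue (wact v s) w) phi.
Proof.
rewrite tmx_pmul; under eq_bigr do rewrite tmx_symm -mulrA mulr_suml.
rewrite -mulr_sumr exchange_big; congr (_ * _); apply: eq_bigr => s _ /=.
rewrite (bigD1 (wact v s)) //= eqxx mul1r big1 ?addr0 // => u.
by rewrite eq_sym => /negbTE ->; rewrite mul0r.
Qed.

Lemma tmx_symmr b phi v w :
  tmx (glue v w) (pmul n phi (symm b))
  = #|young b|%:R^-1 * \sum_(s in young b) tmx (glue v (wact w s)) phi.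
Proof.
rewrite tmx_pmul; under eq_bigr do rewrite tmx_symm mulrCA mulr_sumr.
rewrite -mulr_sumr exchange_big; congr (_ * _).
(* The permutation diagram of [s] forces the middle word to be [wact w s^-1]; inverting the
   summation index removes the inverse. *)
rewrite [RHS](reindex_inj invg_inj) /=; apply: eq_big => s; first by rewrite youngV.
move=> _; rewrite (bigD1 (wact w s^-1%g)) //= wactKV eqxx mulr1 big1 ?addr0 // => u.
have [<-|_ _] := eqVneq (wact u s) w; last by rewrite mulr0.
by rewrite wactK eqxx.
Qed.

Lemma tmx_sandwich a b phi v w :
  tmx (glue v w) (sandwich n a b phi)
  = #|young a|%:R^-1 * #|young b|%:R^-1 *
    \sum_(s in young a) \sum_(s' in young b) tmx (glue (wact v s) (wact w s')) phi.
Proof.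
rewrite sandwichE tmx_symmr; under eq_bigr do rewrite tmx_symml.
by rewrite -mulr_sumr mulrA exchange_big [in RHS](mulrC #|young a|%:R^-1).
Qed.

Lemma tmx_sandwich_wact a b phi v w s s' : s \in young a -> s' \in young b ->
  tmx (glue (wact v s) (wact w s')) (sandwich n a b phi)
  = tmx (glue v w) (sandwich n a b phi).
Proof.
move=> sa sb; rewrite !tmx_sandwich; congr (_ * _).
rewrite [RHS](reindex_inj (mulIg s)); apply: eq_big => t.
  by rewrite -[in RHS]youngV invMg youngMl ?youngV.
move=> _; rewrite [RHS](reindex_inj (mulIg s')); apply: eq_big => t'.
  by rewrite -[in RHS]youngV invMg youngMl ?youngV.
by rewrite !wactM.
Qed.

Lemma tmx_vact p v w s s' :
  tmx (glue v w) (Ldiag (vact s s' p)) = tmx (glue (wact v s) (wact w s')) (Ldiag p).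
Proof. by rewrite !tmx_diag compat_vact (eq_compat _ (glue_vperm _ _ _ _)). Qed.

Lemma sum_young_wact (G : word -> word -> F) a b v w s s' :
    s \in young a -> s' \in young b ->
  \sum_(t in young a) \sum_(t' in young b) G (wact (wact v t) s) (wact (wact w t') s')
  = \sum_(t in young a) \sum_(t' in young b) G (wact v t) (wact w t').
Proof.
move=> sa sb; rewrite [RHS](reindex_inj (mulgI s)); apply: eq_big => t.
  by rewrite youngMl.
move=> _; rewrite [RHS](reindex_inj (mulgI s')); apply: eq_big => t'.
  by rewrite youngMl.
by rewrite !wactM.
Qed.

(** * Algebra identities checked on matrix entries *)

Hypothesis (charF : [pchar F] =i pred0) (n_ge2r : (2 * r <= n)%N).

Lemma card_young_unit a : #|young a|%:R != 0 :> F.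
Proof. by rewrite ((pcharf0P F).1 charF) -lt0n card_young_gt0. Qed.

(** Averaging leaves invariant entries unchanged. With [tmx_sandwich_wact], this identifies [corner]
    with the elements whose entries are invariant under the two Young subgroups. *)
Lemma sandwich_fix a b phi :
    (forall v w s s', s \in young a -> s' \in young b ->
       tmx (glue (wact v s) (wact w s')) phi = tmx (glue v w) phi) ->
  sandwich n a b phi = phi.
Proof.
move=> phiP; apply: (tmx_inj n_ge2r) => v w; rewrite tmx_sandwich.
under eq_bigr => s sa do (under eq_bigr => s' sb do rewrite phiP //; rewrite sumr_const).
rewrite sumr_const -mulrnA -[X in _ * X]mulr_natl mulrA -invfM -natrM mulnC mulVf ?mul1r //.
by rewrite natrM mulf_neq0 ?card_young_unit.
Qed.

Lemma pmulA phi psi chi : pmul n phi (pmul n psi chi) = pmul n (pmul n phi psi) chi.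
Proof.
apply: (tmx_inj n_ge2r) => v w; rewrite !tmx_pmul.
under eq_bigr do rewrite tmx_pmul mulr_sumr.
rewrite exchange_big; apply: eq_bigr => u _; rewrite tmx_pmul mulr_suml.
by apply: eq_bigr => u' _; rewrite mulrA.
Qed.

Lemma pmul_symm a : pmul n (symm a) (symm a) = symm a.
Proof.
apply: (tmx_inj n_ge2r) => v w; rewrite tmx_symml.
rewrite (eq_bigr (fun=> tmx (glue v w) (symm a))) => [|s sa].
  by rewrite sumr_const -[X in _ * X]mulr_natl mulKf // card_young_unit.
rewrite !tmx_symm; congr (_ * _).
rewrite [RHS](reindex_inj (mulIg s)); apply: eq_big => t; last by rewrite wactM.
by rewrite -[in RHS]youngV invMg youngMl ?youngV.
Qed.

Lemma pmul_perm_diag s q : pmul n (Ldiag (perm_diag s)) (Ldiag q) = Ldiag (act_diag s q).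
Proof.
apply: (tmx_inj n_ge2r) => v w; rewrite tmx_pmul tmx_diag compat_act_diag.
rewrite (eq_compat _ (glue_relabel v w s)) (bigD1 (wact v s)) //= !tmx_diag.
rewrite compat_perm_diag eqxx mul1r big1 ?addr0 // => u.
by rewrite tmx_diag compat_perm_diag eq_sym => /negbTE ->; rewrite mul0r.
Qed.

(** The two inner copies of [symm b] merge into one by idempotence; expanding it over [young b] lets
    each permutation diagram act on [q]. *)
Lemma pmul_sandwich a b c p q :
  pmul n (sandwich n a b (Ldiag p)) (sandwich n b c (Ldiag q))
  = #|young b|%:R^-1 *: \sum_(s in young b)
      sandwich n a c (pmul n (Ldiag p) (Ldiag (act_diag s q))).
Proof.
have -> : pmul n (sandwich n a b (Ldiag p)) (sandwich n b c (Ldiag q))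
    = sandwich n a c (pmul n (Ldiag p) (pmulr (Ldiag q) (symm b))).
  rewrite !sandwichE /pmulr; move: (pmul_symm b) (Ldiag p) (Ldiag q) => bb P Q.
  move: (symm a) (symm b) (symm c) bb => A B C BB.
  rewrite -(pmulA A) -(pmulA B Q) (pmulA _ B (pmul n Q C)) -(pmulA A) -(pmulA P) BB.
  by rewrite (pmulA _ Q C) -(pmulA A) -(pmulA P).
rewrite symmE !linearZ /=; congr (_ *: _).
rewrite (linear_sum (pmulr _)) (linear_sum (pmul n _)) linear_sum; apply: eq_bigr => s _.
by congr (sandwich n a c (pmul n _ _)); exact: pmul_perm_diag.
Qed.

Lemma sandwich_diag a b p :
  sandwich n a b (Ldiag p)
  = (#|young a|%:R^-1 * #|young b|%:R^-1) *:
    \sum_(s in young a) \sum_(s' in young b) Ldiag (vact s s' p).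
Proof.
apply: (tmx_inj n_ge2r) => v w; rewrite tmx_sandwich tmxZ tmx_sum.
congr (_ * _); apply: eq_bigr => s _; rewrite tmx_sum; apply: eq_bigr => s' _.
by rewrite /= !tmx_diag compat_vact (eq_compat _ (glue_vperm _ _ _ _)).
Qed.

Lemma sandwich_kappa a b p q : kappa a b p = kappa a b q ->
  sandwich n a b (Ldiag p) = sandwich n a b (Ldiag q).
Proof.
move=> /kappa_eq_vact[s [s' [sa sb ->]]]; apply: (tmx_inj n_ge2r) => v w.
apply: etrans (tmx_sandwich _ _ _ _ _) _; apply: etrans _ (esym (tmx_sandwich _ _ _ _ _)).
apply: (congr1 ( *%R _)).
apply: etrans (esym (sum_young_wact (fun v w => tmx (glue v w) (Ldiag p)) v w sa sb)) _.
by apply: eq_bigr => t _; apply: eq_bigr => t' _; exact: (esym (tmx_vact _ _ _ _ _)).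
Qed.

(** * The dual functionals and the basis *)

Definition kappa_weight a b (m : mpart r k) phi : F := \sum_(q | kappa a b q == m) phi q.

Lemma kappa_weight_is_linear a b m : linear (kappa_weight a b m : palg -> F^o).
Proof.
move=> c x y; rewrite /kappa_weight scaler_sumr -big_split.
by apply: eq_bigr => q _; rewrite !ffunE.
Qed.

HB.instance Definition _ a b m :=
  GRing.isLinear.Build F palg F^o *:%R (kappa_weight a b m) (kappa_weight_is_linear a b m).

Lemma kappa_weightZ a b m x phi :
  kappa_weight a b m (x *: phi) = x * kappa_weight a b m phi.
Proof. exact: linearZ. Qed.

Lemma kappa_weight_sum a b m (I : Type) (s : seq I) (P : pred I) (G : I -> palg) :
  kappa_weight a b m (\sum_(i <- s | P i) G i)
  = \sum_(i <- s | P i) kappa_weight a b m (G i).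
Proof. exact: linear_sum. Qed.

Lemma kappa_weight_diag a b m q : kappa_weight a b m (Ldiag q) = (kappa a b q == m)%:R.
Proof.
rewrite /kappa_weight big_mkcond (bigD1 q) //= big1 ?addr0 => [|q' /negbTE q'q].
  by rewrite LdiagE eqxx; case: eqP.
by rewrite LdiagE q'q if_same.
Qed.

(** Every diagram in the average has the same colouring as [p], and the weights of the average add
    up to 1. *)
Lemma kappa_weight_sandwich a b m p :
  kappa_weight a b m (sandwich n a b (Ldiag p)) = (kappa a b p == m)%:R.
Proof.
rewrite sandwich_diag kappa_weightZ kappa_weight_sum.
rewrite (eq_bigr (fun=> #|young b|%:R * (kappa a b p == m)%:R)) => [|s sa].
  rewrite sumr_const -[X in _ * X]mulr_natl mulrACA.
  by rewrite mulVf ?card_young_unit // mul1r mulKf ?card_young_unit.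
rewrite kappa_weight_sum (eq_bigr (fun=> (kappa a b p == m)%:R)) => [|s' sb].
  by rewrite sumr_const mulr_natl.
by rewrite kappa_weight_diag kappa_vact.
Qed.

Lemma DbasisE m p : kappa (umult m) (bmult m) p = m ->
  Dbasis F n m
  = summand_inj (umult m) (bmult m) (sandwich n (umult m) (bmult m) (Ldiag p)).
Proof.
move=> pm; rewrite /Dbasis; case: pickP => [q /eqP qm|/(_ p)]; last by rewrite pm eqxx.
apply: (congr1 (summand_inj _ _)); apply: sandwich_kappa; exact: (etrans qm (esym pm)).
Qed.

Lemma Dbasis_kappa a b p :
  Dbasis F n (kappa a b p) = summand_inj a b (sandwich n a b (Ldiag p)).
Proof.
have [ua ub] := kappa_mult a b p.
by rewrite (@DbasisE _ p) ua ub.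
Qed.

(** Biorthogonality: elements of another summand vanish at [(umult m, bmult m)], and within one
    summand the fibres of [kappa] separate them. *)
Lemma kappa_weight_Dbasis m m' :
  kappa_weight (umult m) (bmult m) m (Dbasis F n m' (umult m, bmult m)) = (m == m')%:R.
Proof.
have [p <-] := kappa_surj m'; move: (umult m') (bmult m') => a b.
rewrite Dbasis_kappa summand_injE; case: eqP => [abE|neq].
  have [-> ->] : umult m = a /\ bmult m = b.
    by split; [exact: (congr1 fst abE) | exact: (congr1 snd abE)].
  by rewrite kappa_weight_sandwich eq_sym.
have -> : kappa_weight (umult m) (bmult m) m 0 = 0 by exact: linear0.
case: eqP => // mE; case: neq; rewrite mE.
by have [-> ->] := kappa_mult a b p.
Qed.

Lemma Ldiag_decomp phi : phi = \sum_p phi p *: Ldiag p.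
Proof.
apply/ffunP => q; rewrite sum_ffunE (bigD1 q) //= big1 ?addr0 => [|p /negbTE pq].
  by rewrite ffunE LdiagE eqxx /GRing.scale /= mulr1.
by rewrite ffunE LdiagE eq_sym pq scaler0.
Qed.

Lemma Dbasis_basis : basis_of (painted F r k n) [seq Dbasis F n m | m : mpart r k].
Proof.
apply/andP; split; last first.
  rewrite -/(codom (Dbasis F n)) -[X in free X]/(tval (codom_tuple (Dbasis F n))).
  apply/freeP => c c0 i.
  pose m := enum_val i.
  have := congr1 (fun x : painted_fam F r k =>
                    kappa_weight (umult m) (bmult m) m (x (umult m, bmult m))) c0.
  rewrite /= sum_ffunE kappa_weight_sum ffunE.
  have -> : kappa_weight (umult m) (bmult m) m 0 = 0 by exact: linear0.
  rewrite (bigD1 i) //= big1 ?addr0 => [|j ji].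
    by rewrite nth_codom ffunE kappa_weightZ kappa_weight_Dbasis eqxx mulr1.
  rewrite nth_codom ffunE kappa_weightZ kappa_weight_Dbasis (inj_eq enum_val_inj) eq_sym.
  by rewrite (negbTE ji) mulr0.
rewrite eqEsubv; apply/andP; split.
  apply/span_subvP => _ /imageP[m _ ->]; have [p <-] := kappa_surj m.
  rewrite Dbasis_kappa; apply/paintedP => a b; rewrite summand_injE; case: eqP => [[-> ->]|_].
    by exists (Ldiag p).
  by exists 0; rewrite linear0.
(* Spanning: by linearity each corner is generated by the sandwiched diagrams, which are the
   elements attached to [kappa a b p]. *)
apply/subv_sumP => -[a b] _; apply/subvP => _ /memv_imgP[_ /memv_imgP[phi _ ->] ->].
rewrite !lfunE /= (Ldiag_decomp phi) (linear_sum (sandwich n a b)).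
rewrite (linear_sum (summand_inj a b)); apply: memv_suml => p _.
rewrite (linearZZ (sandwich n a b)) (linearZZ (summand_inj a b)) /= -Dbasis_kappa.
apply/memvZ/memv_span.
exact: codom_f.
Qed.

Lemma painted_mul_Dbasis m m' p q :
    kappa (umult m) (bmult m) p = m -> kappa (umult m') (bmult m') q = m' ->
  painted_mul n (Dbasis F n m) (Dbasis F n m')
  = ((bmult m == umult m')%:R / #|young (bmult m)|%:R) *:
    \sum_(s in young (bmult m)) summand_inj (umult m) (bmult m')
      (sandwich n (umult m) (bmult m') (pmul n (Ldiag p) (Ldiag (act_diag s q)))).
Proof.
move=> pm qm; rewrite (DbasisE pm) (DbasisE qm) painted_mul_summand.
have [<-|_] := eqVneq (bmult m) (umult m'); last by rewrite mul0r !scale0r.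
by rewrite pmul_sandwich scale1r mul1r linearZ linear_sum.
Qed.

End PaintedAlgebra.

(** * Monomials and coloured words *)

Lemma mpolyX_sum (F : nzRingType) (d : nat) (I : Type) (s : seq I) (P : pred I)
    (G : I -> 'X_{1..d}) :
  'X_[(\sum_(i <- s | P i) G i)%MM] = \prod_(i <- s | P i) 'X_[G i] :> {mpoly F[d]}.
Proof. exact: (big_morph _ (@mpolyXD _ _) (@mpolyX0 _ _)). Qed.

Lemma invmx_perm (F : comUnitRingType) (n : nat) (s : 'S_n) :
  invmx (perm_mx s) = perm_mx s^-1%g :> 'M[F]_n.
Proof.
by rewrite -[RHS](mulKmx (unitmx_perm _ s)) -perm_mxM mulgV perm_mx1 mulmx1.
Qed.

Section ColoredWords.
Variables r k n : nat.
Notation word := {ffun 'I_r -> 'I_n}.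
Notation cword := (wcomp r k * word)%type.
Implicit Types (a b : wcomp r k) (v w : word) (x y : cword) (s : 'S_n).

(** The exponent of the product over [t] of the variables x_ij, with i the letter and j the colour
    of [t]. *)
Definition wmon x : 'X_{1..n * k} :=
  (\sum_(t < r) U_(mxvec_index (x.2 t) (color x.1 t)))%MM.

Lemma wmonE x i j :
  wmon x (mxvec_index i j) = #|[pred t | (color x.1 t == j) && (x.2 t == i)]|.
Proof.
rewrite mnm_sumE -sum1_card [RHS]big_mkcond; apply: eq_bigr => t _.
have idx_inj : injective (uncurry (@mxvec_index n k)).
  by case: (curry_mxvec_bij n k) => g gK _; apply: (can_inj (g := g)) => ij; exact: gK.
rewrite mnm1E.
rewrite -[_ == _]/(uncurry (@mxvec_index n k) (_, _) == uncurry (@mxvec_index n k) (_, _)).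
by rewrite (inj_eq idx_inj) xpair_eqE andbC inE; case: (_ && _).
Qed.

Lemma wmonP x y :
  wmon x = wmon y <->
  forall j i, #|[pred t | (color x.1 t == j) && (x.2 t == i)]|
            = #|[pred t | (color y.1 t == j) && (y.2 t == i)]|.
Proof.
split=> [xy j i|xy]; first by rewrite -!wmonE xy.
by apply/mnmP => l; case/mxvec_indexP: l => i j; rewrite !wmonE.
Qed.

Lemma mdeg_wmon x : mdeg (wmon x) = r.
Proof.
rewrite /wmon mdeg_sum (eq_bigr (fun=> 1%N)) => [|t _]; last exact: mdeg1.
by rewrite sum_nat_const card_ord muln1.
Qed.

(** The degree in the variables of column [j] recovers the part of index [j] of the composition. *)
Lemma wmon_fst x y : wmon x = wmon y -> x.1 = y.1.
Proof.
have wE (z : cword) j : val z.1 j = (\sum_i wmon z (mxvec_index i j))%N :> nat.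
  rewrite -card_color -sum1_card (partition_big z.2 xpredT) //=.
  apply: eq_bigr => i _; rewrite wmonE -sum1_card; apply: eq_bigl => t.
  by rewrite !inE.
move=> xy; apply: val_inj; apply/ffunP => j; apply: val_inj.
by apply: etrans (wE x j) (etrans _ (esym (wE y j))); rewrite xy.
Qed.

Lemma wmon_wact a v (s : 'S_r) : s \in young a -> wmon (a, wact v s) = wmon (a, v).
Proof.
move=> /youngP sa; apply/wmonP => j i /=.
rewrite -[RHS](card_image (@perm_inj _ s^-1%g)); apply: eq_card => t.
rewrite -[t in RHS](permK s) mem_image ?inE /=; last exact: perm_inj.
by rewrite ffunE sa.
Qed.

Lemma wmon_eq_wact a v w : wmon (a, v) = wmon (a, w) ->
  exists2 s, s \in young a & wact v s = w.
Proof.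
move/wmonP => /= vw.
have [c|s sE] := @exists_perm_with_counts _ _
    (fun t => (color a t, w t)) (fun t => (color a t, v t)).
  by case: c => j i; exact: (esym (vw j i)).
exists s; first by apply/youngP => t; have [] := sE t.
by apply/ffunP => t; rewrite ffunE; have [] := sE t.
Qed.

(** The column degrees of [m] form the composition, and letters are distributed within each colour
    class with the exponents as counts. *)
Lemma wmon_surj (m : 'X_{1..n * k}) : mdeg m = r -> exists x, wmon x = m.
Proof.
move=> m_r; pose mu (j : 'I_k) (i : 'I_n) := m (mxvec_index i j).
have mu_sum : (\sum_j \sum_i mu j i)%N = r.
  rewrite -m_r mdegE exchange_big pair_bigA /=.
  have [g gK Kg] := curry_mxvec_bij n k.
  rewrite [RHS](reindex (uncurry (@mxvec_index n k))) /=; last first.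
    by exists g => ij _; [exact: gK | exact: Kg].
  by apply: eq_bigr => -[i j].
have le_r j : (\sum_i mu j i < r.+1)%N.
  by rewrite ltnS -[X in (_ <= X)%N]mu_sum [X in (_ <= X)%N](bigD1 j) //= leq_addr.
have aP : (\sum_(j < k) [ffun j => Ordinal (le_r j)] j)%N == r.
  by apply/eqP; rewrite -[RHS]mu_sum; apply: eq_bigr => j _; rewrite ffunE.
have [|v vE] := @exists_fun_with_counts _ _ _ (color (Wcomp aP)) mu.
  by move=> j; rewrite card_color /= ffunE.
exists (Wcomp aP, finfun v); apply/mnmP => l; case/mxvec_indexP: l => i j.
by rewrite wmonE -[RHS]vE; apply: eq_card => t; rewrite !inE ffunE.
Qed.

(** * Renaming the letters of coloured words *)

Definition push s x : cword := (x.1, [ffun t => s (x.2 t)]).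

Lemma pushK s : cancel (push s) (push s^-1%g).
Proof. by case=> a v; congr (_, _); apply/ffunP => t; rewrite !ffunE permK. Qed.

Lemma pushKV s : cancel (push s^-1%g) (push s).
Proof. by case=> a v; congr (_, _); apply/ffunP => t; rewrite !ffunE permKV. Qed.

Lemma push_inj s : injective (push s).
Proof. exact: can_inj (pushK s). Qed.

Lemma wmon_push s x y : (wmon (push s x) == wmon (push s y)) = (wmon x == wmon y).
Proof.
have sub s' x' y' : wmon x' = wmon y' -> wmon (push s' x') = wmon (push s' y').
  move/wmonP => xy; apply/wmonP => j i.
  have pE z : #|[pred t | (color (push s' z).1 t == j) && ((push s' z).2 t == i)]|
      = #|[pred t | (color z.1 t == j) && (z.2 t == (s'^-1)%g i)]|.
    apply: eq_card => t; rewrite !inE /= ffunE; congr (_ && _).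
    by apply/eqP/eqP => [<-|->]; rewrite ?permK ?permKV.
  by rewrite !pE xy.
apply/eqP/eqP => [/(sub s^-1%g)|]; last exact: sub.
by rewrite !pushK.
Qed.

Definition nfib x : nat := #|[pred y | wmon y == wmon x]|.

Lemma nfib_push s x : nfib (push s x) = nfib x.
Proof.
rewrite /nfib -[RHS](card_image (@push_inj s)); apply: eq_card => y.
by rewrite -[y](pushKV s) mem_image ?inE ?wmon_push //; exact: push_inj.
Qed.

(** * Monomials of coloured words as a redundant spanning family *)

Variable F : fieldType.
Notation hpoly := (hpoly F r k n).
Implicit Types (f : hpoly).

Lemma hmono_proof x : ('X_[wmon x] : {mpoly F[n * k]}) \is r.-homog.
Proof. by rewrite dhomogX /= mdeg_wmon. Qed.

Definition hmono x : hpoly := DHomog (hmono_proof x).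

Lemma hmono_eq x y : wmon x = wmon y -> hmono x = hmono y.
Proof. by move=> xy; apply: val_inj; rewrite /= xy. Qed.

(* The monomials of the coloured words are repeated, x sharing its own with nfib x
   words: coord is the averaged choice of coordinates for this spanning family. *)
Definition coord x f : F := (val f)@_(wmon x) / (nfib x)%:R.

Lemma coord_is_linear x : linear (coord x : hpoly -> F^o).
Proof. by move=> c f g; rewrite /coord /= mcoeffD mcoeffZ mulrDl /GRing.scale /= mulrA. Qed.

HB.instance Definition _ x :=
  GRing.isLinear.Build F hpoly F^o *:%R (coord x) (coord_is_linear x).

Lemma coordZ x c f : coord x (c *: f) = c * coord x f.
Proof. exact: linearZ. Qed.

Lemma coord_sum x (I : Type) (s : seq I) (P : pred I) (G : I -> hpoly) :
  coord x (\sum_(i <- s | P i) G i) = \sum_(i <- s | P i) coord x (G i).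
Proof. exact: linear_sum. Qed.

Lemma coord_hmono x y : coord x (hmono y) = (wmon y == wmon x)%:R / (nfib x)%:R.
Proof. by rewrite /coord /= mcoeffX. Qed.

Lemma coord_eq x y f : wmon x = wmon y -> coord x f = coord y f.
Proof. by move=> xy; rewrite /coord /nfib xy. Qed.

Lemma hpoly_act_is_linear (M : 'M[F]_n) : linear (@hpoly_act F r k n M).
Proof.
by move=> c f g; apply: val_inj; rewrite /= /mx_act comp_mpolyD comp_mpolyZ.
Qed.

HB.instance Definition _ (M : 'M[F]_n) :=
  GRing.isLinear.Build F hpoly hpoly *:%R (hpoly_act M) (hpoly_act_is_linear M).

(** Row i of the inverse permutation matrix times X is row [s^-1 i] of X, hence the inverse. *)
Lemma hpoly_act_hmono s x : hpoly_act (perm_mx s) (hmono x) = hmono (push s^-1%g x).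
Proof.
apply: val_inj; rewrite /= /mx_act /wmon !mpolyX_sum rmorph_prod; apply: eq_bigr => t _.
rewrite /= comp_mpolyXU -tnth_nth tnth_mktuple mxvecE invmx_perm map_perm_mx -row_permE.
by rewrite !mxE ffunE.
Qed.

Hypothesis charF : [pchar F] =i pred0.

Lemma nfib_unit x : (nfib x)%:R != 0 :> F.
Proof.
by rewrite ((pcharf0P F).1 charF) -lt0n; apply/card_gt0P; exists x; rewrite inE.
Qed.

Lemma hpoly_decomp f : f = \sum_x coord x f *: hmono x.
Proof.
apply: val_inj; rewrite linear_sum; apply/mpolyP => m; rewrite linear_sum /=.
have [mr|mNr] := eqVneq (mdeg m) r; last first.
  rewrite (dhomog_nemf_coeff (dhomog_is_dhomog f)) // big1 // => x _.
  rewrite mcoeffZ mcoeffX.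
  by case: (wmon x =P m) mNr => [<-|_ _]; rewrite ?mdeg_wmon ?eqxx ?mulr0.
have [x <-] := wmon_surj mr; rewrite (bigID (fun y => wmon y == wmon x)) /=.
rewrite [X in _ + X]big1 ?addr0 => [|y /negbTE yx]; last first.
  by rewrite mcoeffZ mcoeffX yx mulr0.
rewrite (eq_bigr (fun=> coord x f)) => [|y /eqP yx].
  by rewrite sumr_const -[RHS]mulr_natr mulfVK ?nfib_unit.
by rewrite mcoeffZ mcoeffX yx eqxx mulr1; apply: coord_eq.
Qed.

(** The fibre of [y] contributes [nfib y] equal terms of weight [1 / nfib y], so a function of the
    monomial survives the redundancy of the family. *)
Lemma sum_coord_hmono (G : cword -> F) y :
    (forall x x', wmon x = wmon x' -> G x = G x') ->
  \sum_x G x * coord y (hmono x) = G y.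
Proof.
move=> Geq; rewrite (bigID (fun x => wmon x == wmon y)) /=.
rewrite [X in _ + X]big1 ?addr0 => [|x /negbTE xy]; last first.
  by rewrite coord_hmono xy mul0r mulr0.
rewrite (eq_bigr (fun=> G y / (nfib y)%:R)) => [|x /eqP xy].
  by rewrite sumr_const -[LHS]mulr_natr mulfVK ?nfib_unit.
by rewrite coord_hmono xy eqxx mul1r (Geq _ _ xy).
Qed.

Lemma sum_hmono_coord (G : cword -> F) y :
    (forall x x', wmon x = wmon x' -> G x = G x') ->
  \sum_x coord x (hmono y) * G x = G y.
Proof.
move=> Geq; rewrite -[RHS](sum_coord_hmono _ Geq); apply: eq_bigr => x _.
rewrite mulrC !coord_hmono eq_sym; case: eqP => [xy|_]; last by rewrite !mul0r.
by rewrite /nfib xy.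
Qed.

Lemma coord_act s x f : coord (push s^-1%g x) (hpoly_act (perm_mx s) f) = coord x f.
Proof.
rewrite [f in LHS]hpoly_decomp [f in RHS]hpoly_decomp linear_sum !coord_sum.
apply: eq_bigr => y _; rewrite linearZ /= !coordZ hpoly_act_hmono !coord_hmono.
by rewrite wmon_push nfib_push.
Qed.

End ColoredWords.

(** * The painted algebra as the multiset partition algebra *)

Section PaintedAction.
Variables (F : fieldType) (r k n : nat).
Notation word := {ffun 'I_r -> 'I_n}.
Notation cword := (wcomp r k * word)%type.
Notation hpoly := (hpoly F r k n).
Notation painted_fam := (painted_fam F r k).
Notation painted := (painted F r k n).
Implicit Types (a b : wcomp r k) (v w : word) (i j l : cword) (x y : painted_fam).
Implicit Types (f : hpoly) (s : 'S_n).

(** Entries of a block matrix indexed by coloured words, [x (a, b)] supplying the block with rows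
    coloured by [a] and columns by [b]. *)
Definition pmx x i j : F := tmx (glue i.2 j.2) (x (i.1, j.1)).

Definition painted_act x f : hpoly := \sum_j coord j f *: \sum_i pmx x i j *: hmono F i.

Lemma painted_act_is_linear x : linear (painted_act x).
Proof.
move=> c f g; rewrite /painted_act scaler_sumr -big_split; apply: eq_bigr => j _ /=.
by rewrite scalerA -scalerDl; congr (_ *: _); exact: linearP.
Qed.

HB.instance Definition _ x :=
  GRing.isLinear.Build F hpoly hpoly *:%R (painted_act x) (painted_act_is_linear x).

Lemma pmx_linear c x y i j : pmx (c *: x + y) i j = c * pmx x i j + pmx y i j.
Proof. by rewrite /pmx !ffunE; exact: linearP. Qed.

Lemma painted_act_linearl c x y f :
  painted_act (c *: x + y) f = c *: painted_act x f + painted_act y f.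
Proof.
rewrite /painted_act scaler_sumr -big_split; apply: eq_bigr => j _ /=.
rewrite scalerA (mulrC c) -(scalerA (coord j f) c) -scalerDr; congr (_ *: _).
rewrite scaler_sumr -big_split; apply: eq_bigr => i _ /=.
by rewrite pmx_linear scalerDl scalerA.
Qed.

(** Equal monomials come from the same composition and from words conjugate under its Young
    subgroup, and elements of a corner have invariant entries. *)
Lemma pmx_painted x i i' j j' : x \in painted ->
  wmon i = wmon i' -> wmon j = wmon j' -> pmx x i j = pmx x i' j'.
Proof.
move=> /paintedP xP ii' jj'; rewrite /pmx.
case: i i' j j' ii' jj' => [a v] [a' v'] [b w] [b' w'] ii' jj'.
have /= aa' := wmon_fst ii'; have /= bb' := wmon_fst jj'.
rewrite -{}aa' -{}bb' in ii' jj' *.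
have [s sa <-] := wmon_eq_wact ii'; have [s' sb <-] := wmon_eq_wact jj'.
by have [phi ->] := xP a b; rewrite /= tmx_sandwich_wact.
Qed.

Lemma pmx_mul x y i j : pmx (painted_mul n x y) i j = \sum_l pmx x i l * pmx y l j.
Proof.
rewrite /pmx ffunE tmx_sum -(pair_bigA _ (fun b u => pmx x i (b, u) * pmx y (b, u) j)) /=.
by apply: eq_bigr => b _; rewrite tmx_pmul.
Qed.

Lemma pmx_push s x i j : pmx x (push s i) (push s j) = pmx x i j.
Proof.
rewrite /pmx /=; apply: eq_bigr => p _; congr (_ * (nat_of_bool _)%:R).
have gE u : glue [ffun t => s (i.2 t)] [ffun t => s (j.2 t)] u = s (glue i.2 j.2 u).
  by case: u => t; rewrite /= ffunE.
apply: eq_forallb => u; apply: eq_forallb => u'.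
by rewrite !gE (inj_eq perm_inj).
Qed.

Hypothesis charF : [pchar F] =i pred0.

(** Repeated monomials make coordinates average over fibres; entries of a painted element are
    constant there, so the usual matrix sum remains. *)
Lemma coord_painted_act x l f : x \in painted ->
  coord l (painted_act x f) = \sum_j coord j f * pmx x l j.
Proof.
move=> xP; rewrite coord_sum; apply: eq_bigr => j _; rewrite coordZ; congr (_ * _).
rewrite coord_sum; under eq_bigr do rewrite coordZ.
by apply: (sum_coord_hmono charF) => i i' ii'; apply: pmx_painted.
Qed.

Lemma coord_painted_act_hmono x i j : x \in painted ->
  coord i (painted_act x (hmono F j)) = pmx x i j.
Proof.
move=> xP; rewrite coord_painted_act //.
apply: (sum_hmono_coord charF (G := pmx x i)) => l l' ll'.
exact: pmx_painted.
Qed.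

Lemma painted_act_mul x y f : y \in painted ->
  painted_act (painted_mul n x y) f = painted_act x (painted_act y f).
Proof.
move=> yP; rewrite /painted_act -/(painted_act y f).
under [RHS]eq_bigr do rewrite coord_painted_act // scaler_suml.
rewrite [RHS]exchange_big; apply: eq_bigr => j _ /=.
under [RHS]eq_bigr do rewrite -scalerA.
rewrite -scaler_sumr; congr (_ *: _); under [RHS]eq_bigr do rewrite scaler_sumr.
rewrite [RHS]exchange_big; apply: eq_bigr => i _ /=.
rewrite pmx_mul scaler_suml; apply: eq_bigr => l _.
by rewrite scalerA mulrC.
Qed.

(** [symm b] replaces a word by the average of its rearrangements under [young b], all of which give
    the same monomial. *)
Lemma painted_act_one f : painted_act (painted_one F r k) f = f.
Proof.
rewrite [RHS](hpoly_decomp charF); apply: eq_bigr => -[b w] _; congr (_ *: _).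
transitivity (\sum_a \sum_v pmx (painted_one F r k) (a, v) (b, w) *: hmono F (a, v)).
  by rewrite pair_bigA; apply: eq_bigr => -[a v].
rewrite (bigD1 b) //= [X in _ + X]big1 ?addr0 => [|a /negbTE ab]; last first.
  apply: big1 => v _; rewrite /pmx ffunE /= ab.
  by rewrite (_ : tmx _ _ = 0) ?scale0r //; exact: linear0.
under eq_bigr do rewrite /pmx ffunE eqxx tmx_symm -scalerA scaler_suml /=.
rewrite -scaler_sumr exchange_big (eq_bigr (fun=> hmono F (b, w))) => [|s sb] /=.
  by rewrite sumr_const -scaler_nat scalerA mulVf ?scale1r ?card_young_unit.
rewrite (bigD1 (wact w s^-1%g)) //= wactKV eqxx scale1r big1 ?addr0 => [|v].
  by apply: hmono_eq; rewrite wmon_wact // youngV.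
have [<-|_ _] := eqVneq (wact v s) w; last by rewrite scale0r.
by rewrite wactK eqxx.
Qed.

Lemma painted_act_equivariant x : Sn_equivariant (painted_act x).
Proof.
move=> s f; rewrite [in RHS]/painted_act linear_sum /painted_act.
rewrite (reindex_inj (@push_inj r k n s^-1%g)); apply: eq_bigr => j _ /=.
rewrite coord_act // linearZ /=; congr (_ *: _); rewrite [RHS]linear_sum.
rewrite (reindex_inj (@push_inj r k n s^-1%g)); apply: eq_bigr => i _ /=.
by rewrite linearZ /= pmx_push hpoly_act_hmono.
Qed.

Hypothesis n_ge2r : (2 * r <= n)%N.

Lemma painted_act_inj x y : x \in painted -> y \in painted ->
  painted_act x =1 painted_act y -> x = y.
Proof.
move=> xP yP xy; apply/ffunP => -[a b]; apply: (tmx_inj n_ge2r) => v w.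
rewrite -[LHS]/(pmx x (a, v) (b, w)) -[RHS]/(pmx y (a, v) (b, w)).
by rewrite -!coord_painted_act_hmono // xy.
Qed.

Lemma painted_act_surj (g : {linear hpoly -> hpoly}) : Sn_equivariant g ->
  exists2 x, x \in painted & painted_act x =1 g.
Proof.
move=> g_eq.
(* Coordinates of images of monomials under [g] serve as matrix entries; equivariance of [g] makes
   them invariant under ['S_n]. *)
have [phi phiE] : exists phi : wcomp r k * wcomp r k -> palg F r, forall ab v w,
    tmx (glue v w) (phi ab) = coord (ab.1, v) (g (hmono F (ab.2, w))).
  apply: (@fin_all_exists _ (fun=> palg F r) (fun ab phi => forall v w,
    tmx (glue v w) phi = coord (ab.1, v) (g (hmono F (ab.2, w))))) => ab.
  apply: (tmx_surj n_ge2r) => s v w.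
  rewrite -(coord_act charF s) -g_eq hpoly_act_hmono.
  by rewrite -![(_, [ffun _ => _])]/(push s (_, _)) !pushK.
exists (finfun phi : painted_fam).
  apply/paintedP => a b; exists (phi (a, b)); rewrite ffunE.
  (* Coordinates and monomials depend on words only up to the Young subgroups, so each [phi (a, b)]
     lies in its corner. *)
  apply/esym/(sandwich_fix charF n_ge2r) => v w s s' sa sb; rewrite !phiE /=.
  rewrite (coord_eq _ (wmon_wact v sa)); congr (coord _ (g _)).
  exact/hmono_eq/wmon_wact.
move=> f; rewrite [f in RHS](hpoly_decomp charF) linear_sum; apply: eq_bigr => -[b w] _.
rewrite linearZ /=; congr (_ *: _); rewrite [RHS](hpoly_decomp charF).
by apply: eq_bigr => -[a v] _; rewrite /pmx ffunE phiE.
Qed.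

End PaintedAction.

(** * The statement over the complex numbers *)

Theorem mainTheorem2 (R : realType) (r k n : nat)
    (r_gt0 : (0 < r)%N) (k_gt0 : (0 < k)%N) (n_ge2r : (2 * r <= n)%N) :
  [/\ (* every multiset partition has a preimage under the coloring map *)
      forall m : mpart r k, exists p, kappa (umult m) (bmult m) p = m,
      (* D_m may be computed from any such preimage *)
      forall (m : mpart r k) p, kappa (umult m) (bmult m) p = m ->
        Dbasis R[i] n m =
          summand_inj (umult m) (bmult m)
            (sandwich n (umult m) (bmult m) (Ldiag R[i] p)),
      basis_of (painted R[i] r k n) [seq Dbasis R[i] n m | m : mpart r k],
      forall (m m' : mpart r k) p q,
        kappa (umult m) (bmult m) p = m ->
        kappa (umult m') (bmult m') q = m' ->
        painted_mul n (Dbasis R[i] n m) (Dbasis R[i] n m') =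
          ((bmult m == umult m')%:R / #|young (bmult m)|%:R) *:
            \sum_(s in young (bmult m))
              summand_inj (umult m) (bmult m')
                (sandwich n (umult m) (bmult m')
                  (pmul n (Ldiag R[i] p) (Ldiag R[i] (act_diag s q))))
    & (* isomorphism of algebras onto the S_n-equivariant endomorphisms *)
      exists Phi : painted_fam R[i] r k ->
                   {linear hpoly R[i] r k n -> hpoly R[i] r k n},
      [/\ forall (c : R[i]) x y f,
            x \in painted R[i] r k n -> y \in painted R[i] r k n ->
            Phi (c *: x + y) f = c *: Phi x f + Phi y f,
          forall x y f,
            x \in painted R[i] r k n -> y \in painted R[i] r k n ->
            Phi (painted_mul n x y) f = Phi x (Phi y f),
          forall f, Phi (painted_one R[i] r k) f = f,
          {in painted R[i] r k n &,
            forall x y, Phi x =1 Phi y -> x = y}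
        & forall g : {linear hpoly R[i] r k n -> hpoly R[i] r k n},
            Sn_equivariant g <->
            exists2 x, x \in painted R[i] r k n & Phi x =1 g]].
Proof.
have charC : [pchar R[i]] =i pred0 := Num.Theory.pchar_num R[i].
split.
- exact: kappa_surj.
- by move=> m p; exact: DbasisE.
- exact: Dbasis_basis.
- by move=> m m' p q; exact: painted_mul_Dbasis.
exists (fun x => painted_act x : {linear hpoly R[i] r k n -> hpoly R[i] r k n}).
split=> [c x y f _ _|x y f _ yP|f|x y xP yP|g].
- exact: painted_act_linearl.
- exact: painted_act_mul.
- exact: painted_act_one.
- exact: painted_act_inj.
split=> [|[x _ xg] s f]; first exact: painted_act_surj.
by rewrite -!xg; exact: painted_act_equivariant.
Qed.
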